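(* Let $T$ be a nontrivial tree of order $n(T)$ with $l(T)$ leaves and $s(T)$ support vertices. Then $$\gamma^{d}_2(T)\leq \frac{n(T)+l(T)+s(T)}{4},$$ with equality if and only if there is a labeling $S$ of $T$ such that $(T,S)\in\mathscr{T}_2$.
   Context: Graphs are finite and simple. For a vertex $v$ of a graph $G$, $N(v)$ is its open neighborhood, $N[v]=N(v)\cup\{v\}$, $d(v)=|N(v)|$. A leaf is a vertex of degree $1$; a support vertex is a vertex adjacent to a leaf. For a tree $T$, $n(T)$, $l(T)$, $s(T)$ denote its order, number of leaves and number of support vertices. A set $D\subseteq V(G)$ is a disjunctive dominating set ($2DD$-set) of $G$ if every vertex $v\notin D$ either has a neighbor in $D$ or has at least two vertices of $D$ at distance exactly $2$ from it. $\gamma^{d}_2(G)$ is the minimum size of a $2DD$-set. Labeled trees: a labeling of a tree $T$ is a partition $S=(S_A,S_B,S_C,S_D)$ of $V(T)$ into four (possibly empty) sets; $\mathrm{sta}(v)$ is the letter $x$ with $v\in S_x$. The family $\mathscr{T}_2$ is built from the starting labeled tree $(P_4,S'')$, where $S''$ gives the two leaves of $P_4$ status $C$ and the two internal vertices status $A$; in any tree built from it, this original $P_4$ is called the basic path. Corresponding vertices: if $v$ is a vertex with $\mathrm{sta}(v)=A$ that is not a support vertex and not on the basic path, a vertex $u$ is a corresponding vertex of $v$ if there is an induced path $vv_1v_2u$ with $\mathrm{sta}(v_1)=C$, $\mathrm{sta}(v_2)=D$, $\mathrm{sta}(u)=B$; if $\mathrm{sta}(u)=B$, a vertex $v$ is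 a corresponding vertex of $u$ if there is an induced path $vv_1v_2u$ with $\mathrm{sta}(v)=A$, $\mathrm{sta}(v_1)=C$, $\mathrm{sta}(v_2)=D$. Operation $\mathscr{O}_2$: choose $v$ with $\mathrm{sta}(v)=B$ having a corresponding vertex of degree two; add a new path $u_1u_2$ and the edge $u_1v$, with $\mathrm{sta}(u_1)=A$, $\mathrm{sta}(u_2)=C$. Operation $\mathscr{O}_3$: choose $v$ with $\mathrm{sta}(v)=C$ and $d(v)=1$; add a new path $u_1u_2u_3u_4$ and the edge $u_1v$, with $\mathrm{sta}(u_1)=D$, $\mathrm{sta}(u_2)=B$, $\mathrm{sta}(u_3)=A$, $\mathrm{sta}(u_4)=C$. Operation $\mathscr{O}_4$: choose $v$ not on the basic path with $\mathrm{sta}(v)=A$ having a corresponding vertex of degree two; add a new path $u_1u_2$ and the edge $u_1v$, with $\mathrm{sta}(u_1)=A$, $\mathrm{sta}(u_2)=C$. (Existing vertices keep their statuses.) $\mathscr{T}_2$ is the smallest family of labeled trees containing $(P_4,S'')$ and closed under $\mathscr{O}_2$, $\mathscr{O}_3$, $\mathscr{O}_4$. *)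

(* Defs.v *)
From mathcomp Require Import all_boot.
Set Implicit Arguments. Unset Strict Implicit. Unset Printing Implicit Defensive.

Section Graph.
Variables (V : finType) (e : rel V).

Definition simple_graph : Prop := symmetric e /\ irreflexive e.

Definition is_tree : Prop :=
  simple_graph /\ (forall x y : V, connect e x y) /\
  (forall p : seq V, uniq p -> 3 <= size p -> ~~ cycle e p).

Definition deg (v : V) : nat := #|[set w | e v w]|.
Definition is_leaf (v : V) : bool := deg v == 1.
Definition is_support (v : V) : bool := [exists w, e v w && is_leaf w].
Definition nleaves : nat := #|[set v | is_leaf v]|.
Definition nsupports : nat := #|[set v | is_support v]|.

Definition dist2 (v w : V) : bool :=
  [&& v != w, ~~ e v w & [exists u, e v u && e u w]].

Definition is2DD (D : {set V}) : bool :=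
  [forall v, (v \notin D) ==>
     ([exists w in D, e v w] || (2 <= #|[set w in D | dist2 v w]|))].

(* gamma^d_2 : minimum size of a 2DD-set (V itself is a 2DD-set, so the
   default #|V| does not affect the minimum) *)
Definition gamma2d : nat := \big[minn/#|V|]_(D : {set V} | is2DD D) #|D|.
End Graph.

Inductive status := SA | SB | SC | SD.

Definition add_edge (adj : rel nat) (a b : nat) : rel nat :=
  fun x y => adj x y || ((x == a) && (y == b)) || ((x == b) && (y == a)).
Definition upd (lab : nat -> status) (k : nat) (s : status) : nat -> status :=
  fun x => if x == k then s else lab x.

Definition ndeg (n : nat) (adj : rel nat) (v : nat) : nat := count (adj v) (iota 0 n).
Definition nsupport (n : nat) (adj : rel nat) (v : nat) : Prop :=
  exists w, w < n /\ adj v w /\ ndeg n adj w = 1.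

Definition ind_path4 (n : nat) (adj : rel nat) (a b c d : nat) : Prop :=
  [/\ a < n, b < n, c < n, d < n & uniq [:: a; b; c; d]] /\
  [/\ adj a b, adj b c & adj c d] /\ [/\ ~~ adj a c, ~~ adj b d & ~~ adj a d].

(* The basic path is the vertex set {0,1,2,3}; all later vertices are >= 4. *)
Definition on_basic (v : nat) : bool := v < 4.

Definition corrA n adj (lab : nat -> status) (v u : nat) : Prop :=
  lab v = SA /\ ~ nsupport n adj v /\ ~~ on_basic v /\
  exists v1 v2, ind_path4 n adj v v1 v2 u /\
    lab v1 = SC /\ lab v2 = SD /\ lab u = SB.

Definition corrB n adj (lab : nat -> status) (u v : nat) : Prop :=
  lab u = SB /\
  exists v1 v2, ind_path4 n adj v v1 v2 u /\
    lab v = SA /\ lab v1 = SC /\ lab v2 = SD.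

Definition p4_adj : rel nat :=
  add_edge (add_edge (add_edge (fun _ _ => false) 0 1) 1 2) 2 3.
Definition p4_lab : nat -> status :=
  fun x => match x with 1 | 2 => SA | _ => SC end.

Inductive inT2 : nat -> rel nat -> (nat -> status) -> Prop :=
| T2_base : inT2 4 p4_adj p4_lab
| T2_O2 n adj lab v :
    inT2 n adj lab -> v < n -> lab v = SB ->
    (exists u, u < n /\ corrB n adj lab v u /\ ndeg n adj u = 2) ->
    inT2 n.+2 (add_edge (add_edge adj v n) n n.+1)
              (upd (upd lab n SA) n.+1 SC)
| T2_O3 n adj lab v :
    inT2 n adj lab -> v < n -> lab v = SC -> ndeg n adj v = 1 ->
    inT2 n.+4 (add_edge (add_edge (add_edge (add_edge adj v n) n n.+1)
                          n.+1 n.+2) n.+2 n.+3)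
              (upd (upd (upd (upd lab n SD) n.+1 SB) n.+2 SA) n.+3 SC)
| T2_O4 n adj lab v :
    inT2 n adj lab -> v < n -> ~~ on_basic v -> lab v = SA ->
    (exists u, u < n /\ corrA n adj lab v u /\ ndeg n adj u = 2) ->
    inT2 n.+2 (add_edge (add_edge adj v n) n n.+1)
              (upd (upd lab n SA) n.+1 SC).

(* T admits a labeling S with (T,S) in T_2: T is isomorphic to the
   underlying tree of some member of T_2 (the labeling is transported). *)
Definition has_T2_labeling (V : finType) (e : rel V) : Prop :=
  exists n adj lab, inT2 n adj lab /\
    exists f : V -> nat,
      [/\ forall x, f x < n, injective f,
          forall k, k < n -> exists x, f x = k
        & forall x y, e x y = adj (f x) (f y)].

(* Main.v *)
Require Import Defs.
From mathcomp Require Import all_boot zify.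

(** Root the tree at a leaf and cut it into rooted subtrees. Up to one extra
    vertex, which always allows the root to be chosen, the minimum size of a
    partial disjunctive dominating set of a rooted subtree is described by the
    best condition ([kind]) that it can achieve at the root; attaching a child
    acts on kinds as a finite automaton ([attach]). A [credit] for each kind turns
    the bound into finitely many inequalities, and the attachments where they are
    equalities show that the vertices of an extremal tree split into pieces: pairs
    [a c] with [c] a leaf and [deg a = 2], and paths [a c d b] whose inner vertices
    have degree 2 and one of whose ends has degree 2.

    Conversely every disjunctive dominating set meets every piece, so such a tree
    is extremal. The operations O2, O3, O4 preserve these partitions. A tree with
    such a partition is rebuilt from two adjacent ends of degree 2 by adding
    pieces: a path entered through [a] starts as a pair [a c], O3 completes it
    together with the next pair, and O2, O4 attach a pair at [b], at [a]. *)

Set Implicit Arguments.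
Unset Strict Implicit.
Unset Printing Implicit Defensive.

(** * Splitting a tree at an edge *)

(** The constant 4 is the weight of a piece: a pair accounts for two vertices, one leaf and one
    support vertex, a path for four vertices and nothing else. The automaton is never shown to
    compute true minima. The upper bound only needs each condition to be attained at the stated
    cost, and in the equality case the number of pieces supplies the matching lower bound. The
    obstacle is that domination at distance 2 crosses the cut edge: a child of the root may later be
    served by the root, by a sibling or by the parent of the root. So the state of a subtree records
    both what its root has received and what its children still lack. In the reconstruction, an edge
    leaving a piece starts at an end. If that end has degree above 2, goodness gives the opposite
    end degree 2, and this is exactly the corresponding vertex that O2 and O4 demand. *)

Lemma connect_inv (T : finType) (R : rel T) (Q : pred T) x y :
  (forall u v, R u v -> Q u -> Q v) -> connect R x y -> Q x -> Q y.
Proof.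
move=> RQ /connectP[p]; elim: p x => [|z p IHp] x /= => [_ -> //|].
by case/andP=> Rxz zp ylast Qx; apply: IHp zp ylast _; apply: RQ Rxz Qx.
Qed.

Definition erel (V : finType) (e : rel V) (P : pred V) : rel V :=
  [rel u v | [&& P u, P v & e u v]].

Section Tree.
Variables (V : finType) (e : rel V).
Hypothesis treeV : is_tree e.

Let esym : symmetric e. Proof. by case: treeV => [[]]. Qed.
Let eirr : irreflexive e. Proof. by case: treeV => [[]]. Qed.

Lemma edge_neq x y : e x y -> x != y.
Proof. by apply: contraTneq => ->; rewrite eirr. Qed.

Let acyclic p : 2 < size p -> uniq p -> cycle e p -> False.
Proof. by case: treeV => _ [_ ac] sp Up ep; move: (ac p Up sp); rewrite ep. Qed.

(** Two edges from [r] into a connected set avoiding [r] would close a cycle along a simple path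
    inside that set. *)
Lemma unique_neighbor (P : pred V) r x y :
  ~~ P r -> P x -> connect (erel e P) x y -> e r x -> e r y -> x = y.
Proof.
move=> nPr Px /connectP[p xp ->] erx ery.
case/shortenP: xp ery => p' xp' Up' _ ery.
have ep' : path e x p' by apply: sub_path xp' => u v /and3P[].
have Pp' : all P (x :: p').
  rewrite /= Px /=; elim: p' x xp' {Px erx ery Up' ep'} => //= z q IHq x.
  by case/andP=> /and3P[_ -> _] /IHq ->.
case: p' ep' Pp' Up' ery {xp'} => // z q ep' Pp' Up' ery.
have rNp : r \notin x :: z :: q by apply/negP => /(allP Pp'); apply/negP.
case: (@acyclic (r :: x :: z :: q)) => //; first by rewrite cons_uniq rNp.
change (is_true (path e r (rcons (x :: z :: q) r))); rewrite rcons_path.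
by rewrite -[path _ _ _]/(e r x && path e x (z :: q)) erx ep' esym.
Qed.

Lemma triangle_free x y z : e x y -> e y z -> e x z = false.
Proof.
move=> exy eyz; apply/negP => exz.
apply: (@acyclic [:: x; y; z]) => //=.
  by rewrite !inE !negb_or !edge_neq.
by rewrite exy eyz esym exz.
Qed.

Lemma square_free a b c d : e a b -> e b c -> e c d -> a != c -> b != d ->
  e a d = false.
Proof.
move=> eab ebc ecd nac nbd; apply/negP => ead.
apply: (@acyclic [:: a; b; c; d]) => //=.
  by rewrite !inE !negb_or nac nbd !edge_neq.
by rewrite eab ebc ecd esym ead.
Qed.

Lemma dist2_tree x y z : e x y -> e y z -> x != z -> dist2 e x z.
Proof.
move=> exy eyz nxz; rewrite /dist2 nxz (triangle_free exy eyz) /=.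
by apply/existsP; exists y; rewrite exy.
Qed.

(* [S] consists of [r] and some of the subtrees hanging below [r]; [p] witnesses
   that [r] still has a neighbour outside, so that [r] is not a leaf once it has a
   child. In a [branch] all children of [r] are included and [p] is the parent. *)
Definition plant (S : {set V}) (r p : V) : Prop :=
  [/\ r \in S, p \notin S, e r p &
      forall v w, v \in S -> v != r -> e v w -> w \in S].

Definition branch (S : {set V}) (r p : V) : Prop :=
  plant S r p /\ forall w, e r w -> (w \in S) || (w == p).

(** The component of [x] after deletion of [r]; for an edge [r x], the side of that edge containing
    [x]. *)
Definition away (r x : V) : {set V} := [set y | connect (erel e (predC1 r)) x y].

Lemma branch_away r x : e r x -> r \notin away r x /\ branch (away r x) x r.
Proof.
move=> erx; have nxr : x != r by rewrite eq_sym edge_neq.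
have rA : r \notin away r x.
  rewrite inE; apply/negP => cxr.
  suff: predC1 r r by rewrite /= eqxx.
  by apply: connect_inv cxr nxr => u v /and3P[].
have cA v w : v \in away r x -> e v w -> w != r -> w \in away r x.
  rewrite !inE => xv evw nwr; apply: (connect_trans xv (connect1 _)).
  apply/and3P; split=> //=; apply: contraNneq rA => vr.
  by rewrite inE -[in X in connect _ _ X]vr.
have xA : x \in away r x by rewrite inE connect0.
split=> //; split; last first.
  by move=> w exw; case: (altP (w =P r)) => [->|nwr]; rewrite ?orbT // (cA x).
split=> // [|v w vA nvx evw]; first by rewrite esym.
apply: (cA _ _ vA evw); apply: contraNneq nvx => wr; rewrite wr in evw.
rewrite eq_sym; apply/eqP; apply: (unique_neighbor (P := predC1 r) (r := r)) => //=.
- by rewrite eqxx.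
- by rewrite inE in vA.
- by rewrite esym.
Qed.

(** Only [r] may have neighbours outside [S], so the whole component beyond [x] stays in [S]; it
    touches the rest only through the edge [r x], so removing it spoils nothing at the other
    vertices. *)
Lemma plant_split S r p x : plant S r p -> x \in S -> e r x ->
  away r x \subset S /\ plant (S :\: away r x) r p.
Proof.
move=> [rS pS erp cS] xS erx.
have nxr : x != r by rewrite eq_sym edge_neq.
have [rA [[_ _ _ cA] _]] := branch_away erx.
have AS : away r x \subset S.
  apply/subsetP => y; rewrite inE => cxy.
  apply: (connect_inv (Q := mem S)) cxy xS => u v /and3P[nur nvr euv] uS.
  exact: cS euv.
split=> //; split=> //; [by rewrite in_setD rA | by rewrite in_setD (negPf pS) andbF |].
move=> v w; rewrite !in_setD => /andP[vA vS] nvr evw.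
rewrite (cS v) // andbT; apply: contra vA => wA.
have ewv : e w v by rewrite esym.
have [wx|nwx] := eqVneq w x; last exact: (cA w).
have [_ [_ nx]] := branch_away erx.
by rewrite wx in ewv; case/orP: (nx v ewv) => // /eqP vr; rewrite vr eqxx in nvr.
Qed.

End Tree.

(** * Partial dominating sets *)

Lemma bigminn_le (I : eqType) (s : seq I) (P : pred I) (F : I -> nat) x j :
  j \in s -> P j -> \big[minn/x]_(i <- s | P i) F i <= F j.
Proof.
elim: s => // i s IHs; rewrite inE big_cons => /predU1P[<- ->|js Pj].
  exact: geq_minl.
by case: ifP => _; rewrite ?geq_min IHs ?orbT.
Qed.

Section Dom.
Variables (V : finType) (e : rel V).
Implicit Types (D S : {set V}) (v w r x : V).

Definition nb D v : nat := #|[set w in D | e v w]|.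
Definition nb2 D v : nat := #|[set w in D | dist2 e v w]|.
Definition ok D v : bool := [|| v \in D, 0 < nb D v | 1 < nb2 D v].

Lemma nb_gt0 D v w : w \in D -> e v w -> 0 < nb D v.
Proof. by move=> wD evw; apply/card_gt0P; exists w; rewrite inE wD. Qed.

Lemma nb_gt1 D v a b : a \in D -> b \in D -> a != b -> e v a -> e v b -> 1 < nb D v.
Proof.
move=> aD bD nab eva evb; suff : [set a; b] \subset [set w in D | e v w].
  by move/subset_leq_card; rewrite cards2 nab.
by apply/subsetP => w; rewrite in_set2 in_set => /orP[] /eqP->; apply/andP.
Qed.

Lemma is2DD_ok D : is2DD e D = [forall v, ok D v].
Proof.
apply: eq_forallb => v; rewrite /ok -/(nb2 D v).
case: (v \in D) => //=; congr (_ || _).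
apply/existsP/card_gt0P => -[w]; last by rewrite inE => wD; exists w.
by move=> wD; exists w; rewrite inE.
Qed.

Lemma gamma2d_le D : is2DD e D -> gamma2d e <= #|D|.
Proof. by move=> DD; apply: bigminn_le; rewrite // mem_index_enum. Qed.

Lemma gamma2d_ge k :
  k <= #|V| -> (forall D, is2DD e D -> k <= #|D|) -> k <= gamma2d e.
Proof.
move=> kV kD; apply: (big_ind (fun m => k <= m)) => // m n km kn.
by rewrite leq_min km.
Qed.

Lemma nb_mono D D' v : D \subset D' -> nb D v <= nb D' v.
Proof.
move=> /subsetP sD; apply: subset_leq_card; apply/subsetP => w.
by rewrite !inE => /andP[/sD -> ->].
Qed.

Lemma nb2_mono D D' v : D \subset D' -> nb2 D v <= nb2 D' v.
Proof.
move=> /subsetP sD; apply: subset_leq_card; apply/subsetP => w.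
by rewrite !inE => /andP[/sD -> ->].
Qed.

Lemma ok_mono D D' v : D \subset D' -> ok D v -> ok D' v.
Proof.
move=> sD; rewrite /ok => /or3P[vD|nbD|nb2D]; apply/or3P.
- by apply: Or31; apply: (subsetP sD).
- by apply: Or32; apply: leq_trans (nb_mono _ sD).
- by apply: Or33; apply: leq_trans (nb2_mono _ sD).
Qed.

Lemma card_filterU (P : pred V) D D' : [disjoint D & D'] ->
  #|[set w in D :|: D' | P w]| = #|[set w in D | P w]| + #|[set w in D' | P w]|.
Proof.
move=> dD; rewrite -cardsUI [X in _ = _ + X]eq_card0 ?addn0.
  by apply: eq_card => w; rewrite !inE andb_orl.
move=> w; rewrite !inE; apply/negP => /andP[/andP[wD _] /andP[wD' _]].
by move: (disjointFr dD wD); rewrite wD'.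
Qed.

Lemma nbU D D' v : [disjoint D & D'] -> nb (D :|: D') v = nb D v + nb D' v.
Proof. exact: card_filterU. Qed.

Lemma nb2U D D' v : [disjoint D & D'] -> nb2 (D :|: D') v = nb2 D v + nb2 D' v.
Proof. exact: card_filterU. Qed.

Lemma deg_nb v : deg e v = nb setT v.
Proof. by apply: eq_card => w; rewrite !inE. Qed.

(* The neighbours of the root may still rely on vertices outside [S]: [m] counts
   the vertices of [D] at distance 2 already available to each of them. *)
Definition inside S r D : Prop := r \in D /\ forall v, v \in S -> ok D v.

Definition outside S r D (c g m : nat) : Prop :=
  [/\ r \notin D, c <= nb D r, g <= nb2 D r &
      forall v, v \in S -> v != r -> ok D v || e r v && (m <= nb2 D v)].

Hypothesis treeV : is_tree e.
Let esym : symmetric e. Proof. by case: treeV => [[]]. Qed.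

Lemma outside_le S r D c g m c' g' m' : c' <= c -> g' <= g -> m' <= m ->
  outside S r D c g m -> outside S r D c' g' m'.
Proof.
move=> lec leg lem [rD cD gD sD]; split=> //;
  try exact: leq_trans cD || exact: leq_trans gD.
move=> v vS nvr; case/orP: (sD v vS nvr) => [-> //|/andP[-> mD]].
by rewrite (leq_trans lem mD) orbT.
Qed.

(* The chosen children of [r] are at distance 2 from any child not chosen. *)
Lemma nb_le_nb2 D r v : v \notin D -> e r v -> nb D r <= nb2 D v.
Proof.
move=> vD erv; apply: subset_leq_card; apply/subsetP => w; rewrite !inE.
case/andP=> wD erw; rewrite wD (dist2_tree treeV (y := r)) // 1?esym //.
by apply: contraNneq vD => ->.
Qed.

(** A child that still waits is not chosen itself, so the [c] chosen children are at distance 2 from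
    it. A maximum and not a sum: the [m] vertices already counted may be these very siblings. *)
Lemma outside_sib S r D c g m :
  outside S r D c g m -> outside S r D c g (maxn m c).
Proof.
move=> [rD cD gD sD]; split=> // v vS nvr.
have [//|/=] := boolP (ok D v) => nok.
move: (sD v vS nvr); rewrite (negPf nok) /= => /andP[erv mv].
rewrite erv geq_max mv /= (leq_trans cD) // nb_le_nb2 //.
by apply: contra nok => vD; rewrite /ok vD.
Qed.

Lemma outside_raise S r D c g m :
  outside S r D c g m -> inside S r (r |: D).
Proof.
move=> [rD cD gD sD]; split=> [|v vS]; first by rewrite !inE eqxx.
have [->|nvr] := eqVneq v r; first by rewrite /ok !inE eqxx.
case/orP: (sD v vS nvr) => [|/andP[erv _]].
  by apply: ok_mono; apply: subsetUr.
by apply/or3P/Or32; apply: (nb_gt0 (w := r)); rewrite ?inE ?eqxx // esym.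
Qed.

Section Join.
Variables (S1 S2 D1 D2 : {set V}) (r x : V).
Hypotheses (erx : e r x) (rS1 : r \in S1) (xS2 : x \in S2).
Hypotheses (dS : [disjoint S1 & S2]) (sD1 : D1 \subset S1) (sD2 : D2 \subset S2).
Let D := D1 :|: D2.
Let S := S1 :|: S2.

Let dD : [disjoint D1 & D2].
Proof. exact: disjointWl sD1 (disjointWr sD2 dS). Qed.
Let sub1 : D1 \subset D. Proof. exact: subsetUl. Qed.
Let sub2 : D2 \subset D. Proof. exact: subsetUr. Qed.
Let rD2 : r \notin D2.
Proof. by apply: contraTN rS1 => /(subsetP sD2) rS2; rewrite (disjointFl dS). Qed.
Let xD1 : x \notin D1.
Proof. by apply: contraTN xS2 => /(subsetP sD1) xS1; rewrite (disjointFr dS). Qed.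
Let neqS v : v \in S2 -> v != r.
Proof. by apply: contraTneq => ->; rewrite (disjointFr dS). Qed.
Let neqS1 v : v \in S1 -> v != x.
Proof. by apply: contraTneq => ->; rewrite (disjointFl dS). Qed.

Lemma join_in_in : inside S1 r D1 -> inside S2 x D2 -> inside S r D.
Proof.
move=> [rD1 ok1] [xD2 ok2]; split=> [|v]; rewrite inE ?rD1 //.
by case/orP=> vS; [apply: ok_mono sub1 _; apply: ok1 | apply: ok_mono sub2 _; apply: ok2].
Qed.

(** With [r] chosen, [x] is dominated and [r] is at distance 2 from every child of [x], so each of
    these may lack one vertex. *)
Lemma join_in_out c g :
  inside S1 r D1 -> outside S2 x D2 c g 1 -> inside S r D.
Proof.
move=> [rD1 ok1] [xD2 _ _ ok2].
have rD : r \in D by rewrite inE rD1.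
split=> // v; rewrite inE => /orP[/ok1|vS]; first exact: ok_mono.
have [->|nvx] := eqVneq v x; first by apply/or3P/Or32/(nb_gt0 rD); rewrite esym.
case/orP: (ok2 v vS nvx) => [|/andP[exv m2]]; first exact: ok_mono.
apply/or3P/Or33; rewrite nb2U // -addn1 addnC leq_add //.
apply/card_gt0P; exists r; rewrite inE rD1.
by rewrite (dist2_tree treeV (y := x)) ?neqS // esym.
Qed.

(** The chosen child [x] dominates [r] and is one more vertex at distance 2 for every waiting child
    of [r]. *)
Lemma join_out_in c g m :
  outside S1 r D1 c g m -> inside S2 x D2 -> outside S r D c.+1 g m.+1.
Proof.
move=> [rD1 c1 g1 ok1] [xD2 ok2]; split.
- by rewrite inE negb_or rD1.
- by rewrite nbU // -addn1 leq_add // (nb_gt0 xD2).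
- exact: leq_trans g1 (nb2_mono _ sub1).
move=> v; rewrite inE => /orP[vS nvr|/ok2 okv _]; last by rewrite (ok_mono sub2).
case/orP: (ok1 v vS nvr) => [/(ok_mono sub1) -> //|/andP[erv m1]].
rewrite erv nb2U // -addn1 leq_add ?orbT //.
apply/card_gt0P; exists x; rewrite inE xD2.
by rewrite (dist2_tree treeV (y := r)) ?neqS1 // esym.
Qed.

(** As [r] is not chosen, the children of [x] gain nothing and must already have two vertices. The
    [c'] chosen children of [x] are at distance 2 from [r]. If there are none, [x] itself starts
    waiting, with its [g'] vertices and the [c] chosen siblings. *)
Lemma join_out_out c g m c' g' :
  outside S1 r D1 c g m -> outside S2 x D2 c' g' 2 ->
  outside S r D c (g + c') (if 0 < c' then m else minn m (g' + c)).
Proof.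
move=> [rD1 c1 g1 ok1] [xD2 c2 g2 ok2]; split.
- by rewrite inE negb_or rD1.
- exact: leq_trans c1 (nb_mono _ sub1).
- by rewrite nb2U // leq_add // (leq_trans c2) // nb_le_nb2 // esym.
move=> v; rewrite inE => /orP[vS nvr|vS nvr].
  case/orP: (ok1 v vS nvr) => [/(ok_mono sub1) -> //|/andP[erv m1]].
  have le_m : (if 0 < c' then m else minn m (g' + c)) <= m.
    by case: ifP => // _; apply: geq_minl.
  by rewrite erv (leq_trans (leq_trans le_m m1) (nb2_mono _ sub1)) orbT.
have [->|nvx] := eqVneq v x; last first.
  case/orP: (ok2 v vS nvx) => [/(ok_mono sub2) -> //|/andP[_ m2]].
  by rewrite (ok_mono sub2) // /ok m2 !orbT.
case: ifP => [c'0|_].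
  by rewrite (ok_mono sub2) // /ok (leq_trans c'0 c2) orbT.
rewrite erx geq_min nb2U // [g' + c]addnC leq_add ?orbT //.
by apply: leq_trans c1 _; rewrite nb_le_nb2.
Qed.

End Join.
End Dom.

(* Best condition at the root attainable at minimum cost: [tI] when the root is
   chosen, otherwise the parameters of [outside] are given by [kind_spec], whose
   value at [tI] is junk. [tS] is [tZ0] for a subtree reduced to its root, which
   becomes a leaf when it is attached. *)
Inductive kind := tI | tO2 | tO1 | tN1 | tZ2 | tZ1 | tZ0 | tP1 | tP0 | tS.

Definition kind_spec q : nat * nat * nat :=
  match q with
  | tI | tO2 => (2, 0, 2) | tO1 => (1, 0, 2) | tN1 => (1, 0, 1)
  | tZ2 => (0, 2, 2) | tZ1 => (0, 1, 2) | tZ0 | tS => (0, 0, 2)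
  | tP1 => (0, 0, 1) | tP0 => (0, 0, 0)
  end.

(** Counts are capped at 2, and [g] is dropped once [c] is positive or [m] is below 2; such losses
    are harmless for an upper bound. The value of [m] may also go up: [outside_sib] gives at least
    [c]. *)
Definition classify (s : nat * nat * nat) : kind :=
  match s with
  | (0, g, 0) => tP0 | (0, g, 1) => tP1
  | (0, 0, _) => tZ0 | (0, 1, _) => tZ1 | (0, _, _) => tZ2
  | (1, _, m) => if m <= 1 then tN1 else tO1
  | (_, _, _) => tO2
  end.

(* The second component is the number of additional vertices to choose. *)
Definition attach q1 q2 : kind * nat :=
  let: (c, g, m) := kind_spec q1 in
  let: (c', g', _) := kind_spec q2 in
  match q1, q2 with
  | tI, tP0 => (tI, 1)
  | tI, _ => (tI, 0)
  | _, tI => (classify (c.+1, g, m.+1), 0)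
  | _, tN1 | _, tP1 => (tI, 1)
  | _, tP0 => (classify (c.+1, g, m.+1), 1)
  | _, _ => (classify (c, g + c', if 0 < c' then m else minn m (g' + c)), 0)
  end.

(* The minimum of [weight - 4 * cost] over the subtrees of each kind, found by
   computing the automaton. *)
Definition credit q : nat :=
  match q with
  | tI => 0 | tO2 | tO1 | tS => 1 | tZ2 | tZ1 => 2 | tZ0 | tP1 => 3
  | tP0 | tN1 => 4
  end.

(* The kinds possible when the root has a leaf child. *)
Definition leafy q : bool :=
  match q with tI | tO2 | tN1 | tP0 => true | _ => false end.

Definition is_single q : bool := if q is tS then true else false.

(** The last summand is what the attachment adds to the weights: a child without descendants becomes
    a leaf, and its parent becomes a support vertex unless a leaf child ([l]) had already made it
    one. Each extra chosen vertex costs 4. *)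
Lemma credit_attach q1 q2 (l : bool) : (l -> leafy q1) ->
  credit (attach q1 q2).1 + 4 * (attach q1 q2).2 <=
  credit q1 + credit q2 + (if is_single q2 then (~~ l).+1 else 0).
Proof. by case: q1; case: q2; case: l => // /(_ isT). Qed.

Lemma leafy_attach q1 q2 : leafy q1 || is_single q2 -> leafy (attach q1 q2).1.
Proof. by case: q1; case: q2. Qed.

Lemma single_attach q1 q2 : is_single (attach q1 q2).1 = false.
Proof. by case: q1; case: q2. Qed.

(** * Realising the automaton by vertex sets *)

Section Kinds.
Variables (V : finType) (e : rel V).
Hypothesis treeV : is_tree e.
Implicit Types (D S : {set V}) (v w r x : V).

Definition has_kind S r D q : Prop :=
  if q is tI then inside e S r D
  else let: (c, g, m) := kind_spec q in outside e S r D c g m.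

Lemma classify_has_kind S r D c g m : outside e S r D c g m ->
  has_kind S r D (classify (c, g, m)).
Proof.
case: c => [|[|c]] /= out.
- by case: g m out => [|[|g]] [|[|m]] out; apply: outside_le out.
- have := outside_sib treeV out; case: m {out} => [|[|m]] /= out; 
    by apply: outside_le out => //; rewrite leq_max.
- by have := outside_sib treeV out; apply: outside_le => //; rewrite leq_max orbT.
Qed.

Definition attains S r q k : Prop :=
  exists D, [/\ D \subset S, #|D| <= k & has_kind S r D q].

Lemma attains_raise S r q k : r \in S -> attains S r q k -> attains S r tI k.+1.
Proof.
move=> rS [D [DS Dk]]; have [kI|] : (has_kind S r D q -> has_kind S r D tI) \/
    (has_kind S r D q -> exists c g m, outside e S r D c g m).
  by case: q => /=; [left | right => ?; do 3 eexists; eassumption..].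
  by move=> /kI H; exists D; split=> //; apply: leqW.
move=> H /H [c [g [m out]]]; exists (r |: D); split.
- by rewrite subUset sub1set rS.
- by rewrite cardsU1; case: (r \in D) => /=; lia.
- exact: outside_raise out.
Qed.

Section Attach.
Variables (S1 S2 : {set V}) (r x : V).
Hypotheses (erx : e r x) (rS1 : r \in S1) (xS2 : x \in S2).
Hypothesis dS : [disjoint S1 & S2].

Let combine q1 q2 q k1 k2 k : attains S1 r q1 k1 -> attains S2 x q2 k2 ->
  (forall D1 D2, D1 \subset S1 -> D2 \subset S2 -> has_kind S1 r D1 q1 ->
    has_kind S2 x D2 q2 -> has_kind (S1 :|: S2) r (D1 :|: D2) q) ->
  k1 + k2 <= k -> attains (S1 :|: S2) r q k.
Proof.
move=> [D1 [sD1 D1k h1]] [D2 [sD2 D2k h2]] H lek; exists (D1 :|: D2); split.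
- exact: setUSS.
- by rewrite cardsU; lia.
- exact: H.
Qed.

Let has_kind_in D1 D2 q2 : D1 \subset S1 -> D2 \subset S2 ->
  has_kind S1 r D1 tI -> has_kind S2 x D2 q2 ->
  (if q2 is tP0 then false else true) ->
  has_kind (S1 :|: S2) r (D1 :|: D2) tI.
Proof.
move=> s1 s2 h1 h2 nP0; have [h2'|[c [g [m [m0 h2']]]]] : inside e S2 x D2 \/
    exists c g m, 0 < m /\ outside e S2 x D2 c g m.
  by case: q2 nP0 h2 => //= _ h2; [left | right; do 3 eexists; split; try exact: h2..].
  exact: (join_in_in h1 h2').
apply: (join_in_out treeV erx rS1 dS s1 s2 (c := 0) (g := 0)) => //.
exact: outside_le h2'.
Qed.

Let has_kind_out_in D1 D2 q1 c g m : D1 \subset S1 -> D2 \subset S2 ->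
  has_kind S1 r D1 q1 -> has_kind S2 x D2 tI ->
  kind_spec q1 = (c, g, m) -> (if q1 is tI then false else true) ->
  has_kind (S1 :|: S2) r (D1 :|: D2) (classify (c.+1, g, m.+1)).
Proof.
move=> s1 s2 h1 h2 spec nI; apply: classify_has_kind.
apply: (join_out_in treeV erx) => //.
by move: h1; rewrite /has_kind spec; case: q1 nI {spec}.
Qed.

Let has_kind_out_out D1 D2 q1 q2 c g m c' g' :
  D1 \subset S1 -> D2 \subset S2 ->
  has_kind S1 r D1 q1 -> has_kind S2 x D2 q2 ->
  kind_spec q1 = (c, g, m) -> kind_spec q2 = (c', g', 2) ->
  (if q1 is tI then false else true) -> (if q2 is tI then false else true) ->
  has_kind (S1 :|: S2) r (D1 :|: D2)
    (classify (c, g + c', if 0 < c' then m else minn m (g' + c))).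
Proof.
move=> s1 s2 h1 h2 spec spec' nI nI'; apply: classify_has_kind.
apply: (join_out_out treeV erx) => //.
  by move: h1; rewrite /has_kind spec; case: q1 nI {spec}.
by move: h2; rewrite /has_kind spec'; case: q2 nI' {spec'}.
Qed.

Lemma attains_attach q1 q2 k1 k2 : attains S1 r q1 k1 -> attains S2 x q2 k2 ->
  attains (S1 :|: S2) r (attach q1 q2).1 (k1 + k2 + (attach q1 q2).2).
Proof.
move=> A1 A2; have A1' := attains_raise rS1 A1; have A2' := attains_raise xS2 A2.
(* The three alternatives are: no extra vertex; choosing [x], when its children lack two vertices
   ([tP0]); choosing [r], when they lack one ([tN1], [tP1]). *)
case: q1 A1 => A1; case: q2 A2 => A2 /=; rewrite ?addn0 ?addn1;
  first
  [ apply: (combine A1 A2) => // D1 D2 s1 s2 h1 h2;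
    first [ exact: (has_kind_in s1 s2 h1 h2 isT)
          | exact: (has_kind_out_in s1 s2 h1 h2 erefl isT)
          | exact: (has_kind_out_out s1 s2 h1 h2 erefl erefl isT isT) ]
  | apply: (combine A1 A2') => [D1 D2 s1 s2 h1 h2|];
    [ first [ exact: (has_kind_in s1 s2 h1 h2 isT)
            | exact: (has_kind_out_in s1 s2 h1 h2 erefl isT) ]
    | by rewrite addnS ]
  | apply: (combine A1' A2) => [D1 D2 s1 s2 h1 h2|];
    [ exact: (has_kind_in s1 s2 h1 h2 isT) | by rewrite addSn ] ].
Qed.

End Attach.
End Kinds.

(** * Pieces *)

(** Polymorphic, to serve both for the given tree and for the numbered trees of [inT2]. The bounds
    [1 < d a] and [1 < d b] keep leaves out of paths, so that leaves occur only as second vertices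
    of pairs. *)
Definition good_piece_for (T : Type) (adj : rel T) (d : T -> nat) (s : seq T) : bool :=
  match s with
  | [:: a; c] => [&& adj a c, d a == 2 & d c == 1]
  | [:: a; c; d'; b] =>
      [&& [&& adj a c, adj c d' & adj d' b], d c == 2, d d' == 2,
          (1 < d a) && (1 < d b) & (d a == 2) || (d b == 2)]
  | _ => false
  end.

Section Pieces.
Variables (V : finType) (e : rel V).
Implicit Types (S X Y : {set V}) (v w r x : V).

Definition good_piece : pred (seq V) := good_piece_for e (deg e).

Definition tiled (X : {set V}) : Prop :=
  exists L : seq (seq V),
    [/\ all good_piece L, uniq (flatten L) & flatten L =i X].

Lemma tiled_piece s : good_piece s -> uniq s -> tiled [set x in s].
Proof.
move=> gs Us; exists [:: s]; rewrite /= gs cats0; split=> // x.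
by rewrite inE.
Qed.

Lemma tiledU X Y : [disjoint X & Y] -> tiled X -> tiled Y -> tiled (X :|: Y).
Proof.
move=> dXY [L [gL UL LX]] [M [gM UM MY]]; exists (L ++ M).
rewrite all_cat gL gM flatten_cat cat_uniq UL UM /= andbT; split=> //.
  apply/hasPn => x xM; apply: contraTN dXY => xL.
  by apply/pred0Pn; exists x; rewrite /= -LX -MY xL.
by move=> x; rewrite mem_cat inE LX MY.
Qed.

End Pieces.

(** * Weights of rooted subtrees *)

Section Weight.
Variables (V : finType) (e : rel V).
Hypothesis treeV : is_tree e.
Implicit Types (D S : {set V}) (v w r x : V).
Let esym : symmetric e. Proof. by case: treeV => [[]]. Qed.
Let eirr : irreflexive e. Proof. by case: treeV => [[]]. Qed.

Definition leaf_child S r : bool := [exists w in S, e r w && is_leaf e w].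

(* Whether the root is a leaf is only known once it is attached, so the root never
   counts as a leaf here. *)
Definition weight S r : nat :=
  #|S| + #|[set v in S | (v != r) && is_leaf e v]|
       + #|[set v in S | (v != r) && is_support e v]| + leaf_child S r.

Lemma leaf_neighbor v w w' : is_leaf e v -> e v w -> e v w' -> w = w'.
Proof.
move=> /cards1P[u Eu] evw evw'.
have : w \in [set u] by rewrite -Eu inE.
have : w' \in [set u] by rewrite -Eu inE.
by rewrite !inE => /eqP-> /eqP->.
Qed.

Lemma branch_deg S x r : branch e S x r -> deg e x = (nb e S x).+1.
Proof.
move=> [[xS rS exr _] nx]; rewrite /deg /nb.
have -> : [set w | e x w] = r |: [set w in S | e x w].
  apply/setP => w; rewrite !inE; have [->|nwr] := eqVneq w r; first by rewrite exr.
  by case exw: (e x w); rewrite ?andbF // andbT /=;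
    case/orP: (nx w exw) => // /eqP/eqP; rewrite (negPf nwr).
by rewrite cardsU1 inE (negPf rS).
Qed.

(* Every vertex of [S] other than the root keeps its neighbours in [S], so by
   connectedness a root without children is alone. *)
Lemma plant_single S r p : plant e S r p -> (nb e S r == 0) = (S == [set r]).
Proof.
move=> [rS pS erp cS]; apply/eqP/eqP => [nb0|->]; last first.
  apply: eq_card0 => w; rewrite !inE; apply/negP => /andP[/eqP->].
  by rewrite eirr.
apply/eqP; rewrite eqEsubset sub1set rS andbT; apply/subsetP => v vS.
rewrite inE; apply: contraNT pS => nvr.
have [_ [conn _]] := treeV.
suff : p \in S :\ r by rewrite inE => /andP[].
apply: (connect_inv (Q := mem (S :\ r)) _ (conn v p)); last by rewrite !inE nvr.
move=> u w euw; rewrite !inE => /andP[nur uS].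
rewrite (cS u) // andbT; apply: contraTneq euw => ->; rewrite esym.
by apply/negP => eru; have := nb_gt0 uS eru; rewrite nb0.
Qed.

Section Join.
Variables (S1 S2 : {set V}) (r p x : V).
Hypotheses (erx : e r x) (P1 : plant e S1 r p) (B2 : branch e S2 x r).
Hypotheses (dS : [disjoint S1 & S2]) (pS2 : p \notin S2).

Let rS1 : r \in S1. Proof. by case: P1. Qed.
Let xS2 : x \in S2. Proof. by case: B2 => [[]]. Qed.
Let rS2 : r \notin S2. Proof. by rewrite (disjointFr dS). Qed.

Lemma root_neighbor w : w \in S2 -> e r w -> w = x.
Proof.
move=> wS erw; have [[_ _ _ cS2] _] := B2.
apply/eqP; apply: contraNT rS2 => nwx; apply: (cS2 w) => //; by rewrite esym.
Qed.

Let card_join (P : pred V) :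
  #|[set v in S1 :|: S2 | (v != r) && P v]| =
  #|[set v in S1 | (v != r) && P v]| + #|[set v in S2 | (v != x) && P v]| + P x.
Proof.
rewrite card_filterU // -addnA; congr (_ + _).
rewrite (cardsD1 x) !inE xS2 andTb addnC; congr (_ + _); last first.
  by congr (nat_of_bool _); rewrite (contraNneq _ rS2) // => <-.
apply: eq_card => v; rewrite !inE; case: (v =P x) => [->|_] //=.
  by rewrite andbF.
by case: (v =P r) => [->|_]; rewrite ?(negPf rS2).
Qed.

Lemma leaf_child_join : leaf_child (S1 :|: S2) r = leaf_child S1 r || is_leaf e x.
Proof.
apply/existsP/orP => [[w]|[/existsP[w /andP[wS1 H]]|lx]].
- case/andP; rewrite inE => /orP[wS1|wS2] /andP[erw lw].
    by left; apply/existsP; exists w; rewrite wS1 erw.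
  by right; rewrite -(root_neighbor wS2 erw).
- by exists w; rewrite inE wS1.
- by exists x; rewrite inE xS2 orbT erx.
Qed.

Lemma root_not_leaf : ~~ is_leaf e r.
Proof.
case: P1 => _ _ erp _; apply: contraNN pS2 => lr.
by rewrite (leaf_neighbor lr erp erx).
Qed.

(** The parent [r] has a second neighbour [p], so it is never the leaf that makes [x] a support
    vertex. *)
Lemma support_root : is_support e x = leaf_child S2 x.
Proof.
have [[_ _ _ _] nx] := B2.
apply/existsP/existsP => -[w /andP[]]; last first.
  by move=> wS /andP[exw lw]; exists w; rewrite exw.
move=> exw lw; exists w; rewrite exw lw !andbT.
case/orP: (nx w exw) => // /eqP wr.
by move: lw; rewrite wr (negPf root_not_leaf).
Qed.

(** Once attached, [x] is no longer a root: its leaf status begins to count, while its support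
    status was already counted through [leaf_child S2 x]. The term on the left avoids a
    subtraction. *)
Lemma weight_join :
  weight (S1 :|: S2) r + leaf_child S1 r =
  weight S1 r + weight S2 x + is_leaf e x + (leaf_child S1 r || is_leaf e x).
Proof.
rewrite /weight !card_join leaf_child_join support_root cardsU.
rewrite (disjoint_setI0 dS) cards0.
lia.
Qed.

Lemma leaf_root : is_leaf e x = (S2 == [set x]).
Proof. by rewrite /is_leaf (branch_deg B2) eqSS; have [P2 _] := B2;
  rewrite (plant_single P2). Qed.

End Join.
End Weight.

(** * The bound and its equality case *)

Section Structure.
Variables (V : finType) (e : rel V).
Implicit Types (D S X : {set V}) (v w r x : V) (s : seq V).

(* The vertices of [s] form the unfinished piece containing the root. *)
Definition tiled_off s S : Prop :=
  exists X, [/\ tiled e X, uniq s, {in s, forall v, v \notin X} & S = [set v in s] :|: X].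

Lemma tiled_off0 X : tiled_off [::] X <-> tiled e X.
Proof.
split=> [[Y [tY _ _ ->]]|tX].
  by suff -> : [set v in [::]] :|: Y = Y by []; apply/setP => v; rewrite !inE.
by exists X; split=> //; apply/setP => v; rewrite !inE.
Qed.

Lemma tiled0 : tiled e set0.
Proof. by exists [::]; split=> // v; rewrite inE. Qed.

Lemma tiled_off1 r : tiled_off [:: r] [set r].
Proof.
exists set0; split=> //; first exact: tiled0.
  by move=> v; rewrite !inE.
by rewrite setU0; apply/setP => v; rewrite !inE.
Qed.

Lemma tiled_offU s s' S S' : [disjoint S & S'] -> tiled_off s S ->
  tiled_off s' S' -> tiled_off (s ++ s') (S :|: S').
Proof.
move=> dS [X [tX Us sX ES]] [X' [tX' Us' sX' ES']].
have d v : v \in S -> v \in S' -> false by move=> vS; rewrite (disjointFr dS vS).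
have inS v : v \in S = (v \in s) || (v \in X) by rewrite ES !inE.
have inS' v : v \in S' = (v \in s') || (v \in X') by rewrite ES' !inE.
exists (X :|: X'); split.
- apply: tiledU => //; rewrite disjoint_subset; apply/subsetP => v vX.
  by rewrite inE; apply/negP => vX'; move: (d v);
    rewrite inS inS' vX vX' !orbT => /(_ isT isT).
- rewrite cat_uniq Us Us' andbT; apply/hasPn => v vs'; apply/negP => vs.
  by move: (d v); rewrite inS inS' vs vs' => /(_ isT isT).
- move=> v; rewrite mem_cat inE negb_or => /orP[vs|vs'].
    rewrite sX //=; apply/negP => vX'.
    by move: (d v); rewrite inS inS' vs vX' orbT => /(_ isT isT).
  rewrite sX' // andbT; apply/negP => vX.
  by move: (d v); rewrite inS inS' vs' vX orbT => /(_ isT isT).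
- by apply/setP => v; rewrite !inE inS inS' mem_cat orbACA.
Qed.

Lemma tiled_off_piece s S : good_piece e s -> tiled_off s S -> tiled_off [::] S.
Proof.
move=> gs [X [tX Us sX ->]]; apply/tiled_off0.
apply: tiledU => //; last exact: tiled_piece.
by rewrite disjoint_subset; apply/subsetP => v; rewrite inE => /sX.
Qed.

(** A path piece grows upwards from its lower end: one vertex ([tO1], [tO2]), two ([tZ1], [tZ2]),
    three ([tP1], [tZ0]), the variants recording whether the lower end is known to have degree 2. In
    [tP0] the piece is complete, but good only if the root ends up with degree 2. [tN1] carries no
    information, because no attachment to it or of it is tight. *)
Definition tight_shape q S r : Prop :=
  match q with
  | tI => tiled_off [::] S
  | tO1 => tiled_off [:: r] S /\ nb e S r = 1
  | tO2 => tiled_off [:: r] S /\ 1 < nb e S r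
  | tS => tiled_off [:: r] S /\ nb e S r = 0
  | tZ1 => exists b, [/\ tiled_off [:: r; b] S, e r b, deg e b = 2 & nb e S r = 1]
  | tZ2 => exists b, [/\ tiled_off [:: r; b] S, e r b, 1 < deg e b & nb e S r = 1]
  | tP1 => exists d b, [/\ tiled_off [:: r; d; b] S, e r d && e d b,
             deg e d = 2, deg e b = 2 & nb e S r = 1]
  | tZ0 => exists d b, [/\ tiled_off [:: r; d; b] S, e r d && e d b,
             deg e d = 2, 1 < deg e b & nb e S r = 1]
  | tP0 => (deg e r = 2 -> tiled_off [::] S) /\ nb e S r = 1
  | tN1 => True
  end.

Lemma tight_shape_attach S1 S2 r x q1 q2 (l : bool) :
  symmetric e -> [disjoint S1 & S2] -> e r x -> 1 < deg e r -> deg e x = (nb e S2 x).+1 ->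
  nb e (S1 :|: S2) r = (nb e S1 r).+1 -> (l -> leafy q1) ->
  credit (attach q1 q2).1 + 4 * (attach q1 q2).2 =
    credit q1 + credit q2 + (if is_single q2 then (~~ l).+1 else 0) ->
  tight_shape q1 S1 r -> tight_shape q2 S2 x ->
  tight_shape (attach q1 q2).1 (S1 :|: S2) r.
Proof.
move=> esym dS erx degr degx nbr lq1.
have exr : e x r by rewrite esym.
have tl s s' := @tiled_offU s s' _ _ dS.
have tc s S gs := @tiled_off_piece s S gs.
(* Strict attachments vanish here, their hypothesis being a false equation between numerals. *)
case: q1 lq1; case: q2; case: l => // lq1; try (by move: (lq1 isT));
  rewrite //= => {lq1} _.
all: try by move=> H1 H2; exact: (tl _ _ H1 H2).
all: try by move=> H1 [H2 nb2]; apply: (tl _ _ H1 (H2 _)); lia.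
all: try by case=> H1 nb1 H2; split; [exact: (tl _ _ H1 H2) | rewrite nbr; lia].
all: try by case=> H1 nb1 [H2 nb2]; split;
  [apply: (tl _ _ H1 (H2 _)); rewrite degx nb2 | rewrite nbr; lia].
all: try by case=> H1 nb1 [d [b [H2 /andP[exd edb] dd db nb2]]];
  apply: tc (tl _ _ H1 H2); rewrite /= erx exd edb degx dd db nb2 degr ?orbT.
(* What remains is a lone root receiving its first child: the path gains a vertex ([tO2], [tO1],
   [tZ2], [tZ1]), is closed ([tZ0]), or a pair is formed with a leaf ([tS]). *)
- case=> H1 nb1 [H2 nb2]; exists x; split=> //; [exact: (tl _ _ H1 H2) | lia..].
- case=> H1 nb1 [H2 nb2]; exists x; split=> //; [exact: (tl _ _ H1 H2) | lia..].
- case=> H1 nb1 [b [H2 exb db nb2]]; exists x, b.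
  by rewrite erx exb degx nb2 nbr nb1 db; split=> //; apply: (tl _ _ H1 H2).
- case=> H1 nb1 [b [H2 exb db nb2]]; exists x, b.
  by rewrite erx exb degx nb2 nbr nb1 db; split=> //; apply: (tl _ _ H1 H2).
- case=> H1 nb1 [d [b [H2 /andP[exd edb] dd db nb2]]]; split=> [dr|];
  last by rewrite nbr nb1.
  by apply: tc (tl _ _ H1 H2); rewrite /= erx exd edb degx dd dr nb2 db.
- case=> H1 nb1 [H2 nb2]; split=> [dr|]; last by rewrite nbr nb1.
  by apply: tc (tl _ _ H1 H2); rewrite /= erx dr degx nb2.
Qed.

Hypothesis treeV : is_tree e.
Let esym : symmetric e. Proof. by case: treeV => [[]]. Qed.
Let eirr : irreflexive e. Proof. by case: treeV => [[]]. Qed.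

Lemma plant_bound S r p : plant e S r p -> exists q k,
  [/\ attains e S r q k, leaf_child e S r -> leafy q, is_single q = (S == [set r]),
      4 * k + credit q <= weight e S r &
      4 * k + credit q = weight e S r -> tight_shape q S r].
Proof.
have [n leSn] := ubnP #|S|; elim: n S r p leSn => // n IHn S r p leSn PS.
have [rS pS erp _] := PS.
have [nb0|nb0] := posnP (nb e S r).
  have ES : S = [set r] by apply/eqP; rewrite -(plant_single treeV PS) nb0.
  have noleaf : leaf_child e S r = false.
    apply/existsP => -[w]; rewrite ES !inE => /andP[/eqP-> /andP[]].
    by rewrite eirr.
  have single (P : pred V) : #|[set v in S | (v != r) && P v]| = 0.
    by apply: eq_card0 => v; rewrite ES !inE; case: (v == r).
  exists tS, 0; rewrite noleaf /weight !single noleaf ES cards1 eqxx.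
  split=> //; last by split; [apply: tiled_off1 | rewrite -ES].
  exists set0; rewrite sub0set cards0; split=> //; split=> //; first by rewrite inE.
  by move=> v; rewrite inE => ->.
have [x] := card_gt0P nb0; rewrite inE => /andP[xS erx].
have [S2S P1] := plant_split treeV PS xS erx.
have [rS2 B2] := branch_away treeV erx.
set S2 := away e r x in S2S rS2 B2 P1; set S1 := S :\: S2 in P1.
have xS2 : x \in S2 by case: B2 => [[]].
have rS1 : r \in S1 by case: P1.
have dS : [disjoint S1 & S2] by rewrite -setI_eq0 /S1 setDE -setIA [~: _ :&: _]setIC
  setICr setI0.
have ES : S = S1 :|: S2.
  by rewrite setUC -[LHS](setID S S2) (setIidPr S2S).
have ltS2 : #|S2| < n.
  rewrite -ltnS (leq_trans _ leSn) // ltnS proper_card //.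
  by apply/properP; split=> //; exists r.
have ltS1 : #|S1| < n.
  rewrite -ltnS (leq_trans _ leSn) // ltnS proper_card // ES properUl //.
  by apply/subsetPn; exists x; rewrite // inE xS2.
have [q1 [k1 [A1 l1 s1 W1 T1]]] := IHn _ _ _ ltS1 P1.
have [PB2 _] := B2; have [q2 [k2 [A2 l2 s2 W2 T2]]] := IHn _ _ _ ltS2 PB2.
have pS2 : p \notin S2 by apply: contra pS => /(subsetP S2S).
have lx : is_leaf e x = is_single q2 by rewrite s2 (leaf_root treeV B2).
have ca := credit_attach q2 l1.
have := weight_join treeV erx P1 B2 dS pS2; rewrite -ES lx => W.
exists (attach q1 q2).1, (k1 + k2 + (attach q1 q2).2); split.
- by rewrite ES; exact: (attains_attach treeV erx rS1 xS2 dS A1 A2).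
- rewrite ES (leaf_child_join treeV erx P1 B2 dS) lx => l; apply: leafy_attach.
  by case/orP: l => [/l1 ->|->]; rewrite ?orbT.
- rewrite single_attach; symmetry; apply/eqP => E.
  by move: xS; rewrite E inE eq_sym (negPf (edge_neq treeV erx)).
- move: ca W W1 W2; move: (credit _) (credit q1) (credit q2) (weight _ _ _).
  move=> c c1 c2 w; move: (weight _ _ _) (weight _ _ _) (attach q1 q2).2.
  by case: (is_single q2); case: (leaf_child e S1 r) => /= w1 w2 m; clear; lia.
move=> E; have dx := branch_deg B2.
have dr : 1 < deg e r.
  have := root_not_leaf erx P1 B2 pS2; rewrite /is_leaf.
  suff : 0 < deg e r by case: (deg e r) => [|[]].
  by rewrite deg_nb (nb_gt0 (w := x)) ?inE.
have nbr : nb e (S1 :|: S2) r = (nb e S1 r).+1.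
  rewrite nbU // -addn1; congr (_ + _); apply/eqP/cards1P; exists x.
  apply/setP => w; rewrite in_set in_set1; apply/andP/eqP => [[wS2 erw]|->] //.
  exact: (root_neighbor treeV P1 B2 dS).
(* The bound is the sum of three inequalities, so equality forces equality in each. *)
have [E1 E2 Ec] : [/\ 4 * k1 + credit q1 = weight e S1 r, 4 * k2 + credit q2 = weight e
  S2 x &
    credit (attach q1 q2).1 + 4 * (attach q1 q2).2 = credit q1 + credit q2 +
      (if is_single q2 then (~~ leaf_child e S1 r).+1 else 0)].
  move: E ca W W1 W2; move: (credit _) (credit q1) (credit q2) (weight _ _ _).
  move=> c c1 c2 w; move: (weight _ _ _) (weight _ _ _) (attach q1 q2).2.
  by case: (is_single q2); case: (leaf_child e S1 r) => /= w1 w2 m; clear; split; lia.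
by rewrite ES; apply: (tight_shape_attach esym dS erx dr dx nbr l1 Ec (T1 E1) (T2 E2)).
Qed.

End Structure.

(** The kinds that need no further vertex when the subtree is the whole tree: the root is dominated
    and no child lacks anything. For the others the root is chosen in addition. *)
Definition root_ok q : bool :=
  match q with tI | tO2 | tO1 | tZ2 => true | _ => false end.

(** The 3 stands for the leaf chosen as root: the vertex, its leaf status, and its neighbour as a
    support vertex, where [lc] corrects for a neighbour already counted as such. The 2 appears when
    the neighbour is a leaf too, in the tree on two vertices. *)
Lemma root_credit q (lc : bool) : (lc -> leafy q) ->
  let: (q', m) := attach tS q in
  4 * (m + ~~ root_ok q') + lc <= credit q + 3 + 2 * is_single q /\
  (4 * (m + ~~ root_ok q') + lc = credit q + 3 + 2 * is_single q -> q = tO1).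
Proof. by case: q; case: lc => // /(_ isT). Qed.

(** * From rooted subtrees to the whole tree *)

Section Bound.
Variables (V : finType) (e : rel V).
Hypothesis treeV : is_tree e.
Implicit Types (D S : {set V}) (v w r x : V).
Let esym : symmetric e. Proof. by case: treeV => [[]]. Qed.

Lemma branch_leaf S x r : branch e S x r -> exists2 z, z \in S & is_leaf e z.
Proof.
have [n leSn] := ubnP #|S|; elim: n S x r leSn => // n IHn S x r leSn BS.
have [PS _] := BS; have [xS rS exr _] := PS.
have [nb0|] := posnP (nb e S x).
  by exists x; rewrite // /is_leaf (branch_deg BS) nb0.
case/card_gt0P=> y; rewrite inE => /andP[yS exy].
have [AS _] := plant_split treeV PS yS exy; have [xA BA] := branch_away treeV exy.
have ltA : #|away e x y| < n.
  rewrite -ltnS (leq_trans _ leSn) // ltnS proper_card //.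
  by apply/properP; split=> //; exists x.
by have [z zA lz] := IHn _ _ _ ltA BA; exists z; rewrite // (subsetP AS).
Qed.

Lemma tree_neighbor v : 1 < #|V| -> exists w, e v w.
Proof.
move=> V1; apply/existsP; apply: contraLR V1 => /existsPn nv.
rewrite -leqNgt -(card1 v); apply: subset_leq_card; apply/subsetP => w _.
have [_ [conn _]] := treeV; apply: (connect_inv (Q := pred1 v) _ (conn v w)) => //=.
by move=> x y exy /eqP vx; rewrite vx (negPf (nv y)) in exy.
Qed.

Lemma tree_leaf : 1 < #|V| -> exists z, is_leaf e z.
Proof.
move=> V1; have /card_gt0P[v _] : 0 < #|V| by apply: ltn_trans V1.
have [w evw] := tree_neighbor v V1; have [_ B] := branch_away treeV evw.
by have [z _ lz] := branch_leaf B; exists z.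
Qed.

Lemma root_attains z q k : attains e setT z q k -> gamma2d e <= k + ~~ root_ok q.
Proof.
have inI k' : attains e setT z tI k' -> gamma2d e <= k'.
  move=> [D [_ Dk [_ okD]]]; apply: leq_trans Dk; apply: gamma2d_le.
  by rewrite is2DD_ok; apply/forallP => v; apply: okD.
move=> A; case: (boolP (root_ok q)) => okq; rewrite ?addn0 ?addn1; last first.
  by apply: inI; apply: attains_raise A.
have out D c g m : #|D| <= k -> outside e setT z D c g m -> 1 < m -> (0 < c) || (1 < g) ->
    gamma2d e <= k.
  move=> Dk [zD cD gD sD] m1 cg; apply: leq_trans Dk; apply: gamma2d_le.
  rewrite is2DD_ok; apply/forallP => v; have [->|nvz] := eqVneq v z.
    case/orP: cg => [c0|g0]; apply/or3P; [apply: Or32 | apply: Or33].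
      exact: leq_trans cD.
    exact: leq_trans gD.
  case/orP: (sD v (in_setT _) nvz) => // /andP[_ m2].
  by apply/or3P/Or33; apply: leq_trans m2.
have [D [_ Dk H]] := A.
by case: q okq A H => //= _ A H; [exact: inI | apply: out Dk H _ _..].
Qed.

Lemma gamma2d_bound : 1 < #|V| ->
  4 * gamma2d e <= #|V| + nleaves e + nsupports e /\
  (4 * gamma2d e = #|V| + nleaves e + nsupports e -> tiled e setT).
Proof.
move=> V1; have [z lz] := tree_leaf V1; have [r ezr] := tree_neighbor z V1.
have nz := leaf_neighbor lz ezr; have erz : e r z by rewrite esym.
set S := [set~ z]; have rS : r \in S by rewrite !inE eq_sym (edge_neq treeV).
have PS : plant e S r z.
  split=> //; first by rewrite !inE eqxx.
  move=> v w vS nvr evw; rewrite !inE; apply: contraNneq nvr => wz.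
  by rewrite wz esym in evw; rewrite -(nz _ evw).
have BS : branch e S r z.
  by split=> // w _; rewrite !inE orbC; case: eqP.
have [q [k [A lq sq W T]]] := plant_bound treeV PS.
have ST : setT = [set z] :|: S by apply/setP => v; rewrite !inE; case: eqP.
have dS : [disjoint [set z] & S] by rewrite disjoints1 !inE eqxx.
have Pz : forall P : pred V, P r + #|[set v in S | (v != r) && P v]| = #|[set v in S |
  P v]|.
  move=> P; rewrite [RHS](cardsD1 r) [r \in _]inE rS /=; congr (_ + _).
  by apply: eq_card => v; rewrite !inE andbCA.
have cT (P : pred V) : #|[set v | P v]| = P z + #|[set v in S | P v]|.
  rewrite (cardsD1 z) [z \in _]inE; congr (_ + _).
  by apply: eq_card => v; rewrite !inE.
have lr : is_leaf e r = is_single q by rewrite sq (leaf_root treeV BS).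
have sr : is_support e r by apply/existsP; exists z; rewrite erz.
have sz : is_support e z = is_single q.
  rewrite -lr; apply/existsP/idP => [[w /andP[/nz <-]] //|lr']; by exists r; rewrite ezr.
have total : #|V| + nleaves e + nsupports e + leaf_child e S r =
    weight e S r + 3 + 2 * is_single q.
  rewrite /weight /nleaves /nsupports (cT (is_leaf e)) (cT (is_support e)).
  rewrite -(Pz (is_leaf e)) -(Pz (is_support e)) lz sr sz lr.
  rewrite -cardsT ST cardsU1 !inE eqxx /=.
  move: #|S| #|_| #|_| (leaf_child e S r : nat) (is_single q : nat) => *; lia.
(* The leaf [z] is treated as a lone root to which everything else is attached as its single
   branch. *)
have Az : attains e [set z] z tS 0.
  exists set0; rewrite sub0set cards0; split=> //; split=> //; first by rewrite inE.
  by move=> v; rewrite inE => ->.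
have zz : z \in [set z] by rewrite inE.
have := attains_attach treeV ezr zz rS dS Az A; rewrite -ST => /root_attains.
have := root_credit lq; case Eq: (attach tS q) => [q' m] /= [le_m eq_m] le_g.
have [le_total eq_total] : 4 * gamma2d e <= #|V| + nleaves e + nsupports e /\
    (4 * gamma2d e = #|V| + nleaves e + nsupports e ->
     4 * (m + ~~ root_ok q') + leaf_child e S r = credit q + 3 + 2 * is_single q /\
     4 * k + credit q = weight e S r).
  move: le_g le_m total W; rewrite add0n.
  move: (gamma2d e) (credit q) (nat_of_bool _) (nat_of_bool _) (nat_of_bool _).
  move: #|V| (nleaves e) (nsupports e) (weight e S r) => n l s w g c b b' b''.
  by clear; lia.
split=> // /eq_total[/eq_m Eq1 Ek].
(* In the only tight case [r] is the one vertex not yet in a piece and has degree 2, so it forms a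
   pair with [z]. *)
have [off nb1] : tight_shape e tO1 S r by rewrite -Eq1; apply: T.
apply/tiled_off0; rewrite ST setUC.
apply: (@tiled_off_piece _ _ ([:: r] ++ [:: z])).
  by rewrite /= erz (branch_deg BS) nb1 /= -/(is_leaf e z) lz.
by apply: tiled_offU off (tiled_off1 _ _); rewrite disjoint_sym.
Qed.

End Bound.

(** * Lower bound *)

Lemma uniq_flatten_mem (T : eqType) (L : seq (seq T)) s s' x :
  uniq (flatten L) -> s \in L -> s' \in L -> x \in s -> x \in s' -> s = s'.
Proof.
move=> UL sL; case/path.splitPr: sL UL => L1 L2; rewrite flatten_cat /= => U s'L xs xs'.
apply/eqP; apply: contraTT U => nss'; rewrite uniq_catCA cat_uniq.
suff -> : has (mem s) (flatten L1 ++ flatten L2) by rewrite /= andbF.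
apply/hasP; exists x => //; rewrite -flatten_cat; apply/flattenP; exists s' => //.
by move: s'L; rewrite !mem_cat inE eq_sym (negPf nss').
Qed.

Lemma uniq_flatten_sub (T : eqType) (L : seq (seq T)) s :
  uniq (flatten L) -> s \in L -> uniq s.
Proof.
move=> UL sL; case/path.splitPr: sL UL => L1 L2; rewrite flatten_cat /= !cat_uniq.
by case/and3P=> _ _ /andP[].
Qed.

Lemma sum_flatten_le (T : Type) (L : seq (seq T)) (P : pred (seq T)) (f g : seq T ->
  nat) :
  (forall s, P s -> f s <= g s) -> all P L ->
  sumn [seq f s | s <- L] <= sumn [seq g s | s <- L].
Proof. by move=> fg; elim: L => //= s L IHL /andP[/fg ? /IHL ?]; apply: leq_add. Qed.

Section LowerBound.
Variables (V : finType) (e : rel V).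
Hypothesis simple : simple_graph e.
Implicit Types (D S : {set V}) (v w r x : V).
Let esym : symmetric e. Proof. by case: simple. Qed.

Lemma deg2_neighbor v a b w : deg e v = 2 -> e v a -> e v b -> a != b -> e v w ->
  w = a \/ w = b.
Proof.
move=> dv eva evb nab evw.
have E : [set a; b] = [set u | e v u].
  apply/eqP; rewrite eqEcard cards2 nab -/(deg e v) dv leqnn andbT.
  by apply/subsetP => u; rewrite !inE => /orP[] /eqP ->.
have : w \in [set a; b] by rewrite E inE.
by rewrite !inE => /orP[] /eqP; [left|right].
Qed.

(* All chosen vertices at distance 2 from [c] are reached through [a], which has
   only one neighbour besides [c]. *)
Lemma not_ok D a c : e c a -> deg e a = 2 -> c \notin D -> a \notin D ->
  (forall u w, e c u -> u != a -> u \notin D /\ (e u w -> w \notin D)) -> ok e D c =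
    false.
Proof.
move=> eca da cD aD H; rewrite /ok (negPf cD) /=; apply/norP; split.
  rewrite -leqNgt leqn0; apply/eqP/eq_card0 => u; rewrite !inE.
  apply/negP => /andP[uD ecu]; have [ua|nua] := eqVneq u a.
    by rewrite -ua uD in aD.
  by have [] := H u u ecu nua; rewrite uD.
rewrite -leqNgt -ltnS -da /deg [X in _ < X](cardsD1 c) inE esym eca ltnS.
apply: subset_leq_card; apply/subsetP => w; rewrite !inE => /andP[wD].
case/and3P=> nwc _ /existsP[u /andP[ecu euw]].
rewrite eq_sym nwc /=; have [<- //|nua] := eqVneq u a.
by have [_ /(_ euw)] := H u w ecu nua; rewrite wD.
Qed.

(** If [D] misses the piece, some vertex fails. In a pair it is the leaf [c]. In a path it is the
    inner vertex next to an end of degree 2: beyond that end there is one vertex at distance 2, and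
    on the other side only vertices of the piece. *)
Lemma good_piece_hit D s : uniq s -> good_piece e s -> is2DD e D ->
  0 < count (mem D) s.
Proof.
move=> Us gs; rewrite is2DD_ok => /forallP okD; rewrite -has_count.
case: (boolP (has _ _)) => // /hasPn nD.
case: s Us gs nD => [|a [|c [|d [|b []]]]] //= Us.
  case/and3P=> eac /eqP da /eqP dc nD.
  have [aD cD] : a \notin D /\ c \notin D by split; apply: nD; rewrite !inE eqxx ?orbT.
  have eca : e c a by rewrite esym.
  have := okD c; rewrite (not_ok eca da cD aD) // => u w ecu /eqP[].
  by apply: leaf_neighbor ecu eca; rewrite /is_leaf dc.
case/and4P: Us; rewrite !inE !negb_or => /and3P[nac nad nab] /andP[ncd ncb] ndb _.
case/and5P=> /and3P[eac ecd edb] /eqP dc /eqP dd _ dab nD.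
have inD v : v \in [:: a; c; d; b] -> v \notin D by move=> /nD.
have [aD cD dD bD] : [/\ a \notin D, c \notin D, d \notin D & b \notin D].
  by split; apply: inD; rewrite !inE eqxx ?orbT.
have eca : e c a by rewrite esym.
have ebd : e b d by rewrite esym.
have edc : e d c by rewrite esym.
case/orP: dab => /eqP d2.
  have := okD c; rewrite (not_ok eca d2 cD aD) // => u w ecu nua.
  case: (deg2_neighbor dc eca ecd nad ecu) nua => ->; rewrite ?eqxx // => _.
  by split=> // edw; case: (deg2_neighbor dd edc edb ncb edw) => ->.
have := okD d; rewrite (not_ok edb d2 dD bD) // => u w edu nub.
case: (deg2_neighbor dd edc edb ncb edu) nub => ->; rewrite ?eqxx // => _.
by split=> // ecw; case: (deg2_neighbor dc eca ecd nad ecw) => ->.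
Qed.

Lemma nsupports_le : nsupports e <= nleaves e.
Proof.
pose h w := odflt w [pick v | e w v].
apply: leq_trans (leq_imset_card h _); apply: subset_leq_card; apply/subsetP => v.
rewrite inE => /existsP[w /andP[evw lw]]; apply/imsetP; exists w; rewrite ?inE //.
rewrite /h; case: pickP => [u ewu|/(_ v)]; last by rewrite esym evw.
by apply: (leaf_neighbor lw); rewrite // esym.
Qed.

(** Since supports are at most as numerous as leaves, it suffices that each piece has size plus
    twice its number of leaves at most 4, and that disjoint pieces require distinct chosen
    vertices. *)
Lemma tiled_gamma2d : tiled e setT -> #|V| + nleaves e + nsupports e <= 4 * gamma2d e.
Proof.
move=> [L [gL UL LT]].
have cardL (P : pred V) : #|[set v | P v]| = sumn [seq count P s | s <- L].
  rewrite -count_flatten -size_filter -(card_uniqP (filter_uniq _ UL)).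
  by apply: eq_card => v; rewrite inE mem_filter LT inE andbT.
have ltL D : is2DD e D -> size L <= #|D|.
  move=> DD; have -> : #|D| = sumn [seq count (mem D) s | s <- L].
    by rewrite -cardL; apply: eq_card => v; rewrite inE.
  have -> : size L = sumn [seq 1 | s <- L] by elim: (L) => //= s L0 <-.
  apply: (@sum_flatten_le _ _ (fun s => uniq s && good_piece e s)).
    by move=> s /andP[Us gs]; apply: good_piece_hit.
  by apply/allP => s sL; rewrite (allP gL) // (uniq_flatten_sub UL sL).
have weightL : #|V| + 2 * nleaves e <= 4 * size L.
  have -> : #|V| = sumn [seq size s | s <- L].
    rewrite -cardsT; have := cardL predT.
    by under eq_map do rewrite count_predT.
  rewrite /nleaves cardL; elim: L gL {UL LT cardL ltL} => //= s L IHL /andP[gs gL].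
  suff : size s + 2 * count (is_leaf e) s <= 4 by have := IHL gL; lia.
  case: s gs {IHL gL} => [|a [|c [|d [|b []]]]] //=; rewrite /is_leaf.
    by case/and3P=> _ /eqP-> /eqP->.
  by case/and5P=> _ /eqP-> /eqP-> /andP[]; case: (deg e a) => [|[]] //;
    case: (deg e b) => [|[]].
have := nsupports_le.
suff : size L <= gamma2d e by lia.
(* The default [#|V|] of the minimum is handled by the same bound, applied to the dominating set
   [setT]. *)
apply: gamma2d_ge => //; rewrite -cardsT; apply: ltL; rewrite is2DD_ok.
by apply/forallP => v; rewrite /ok inE.
Qed.

End LowerBound.

(** * Members of the family T2 are tiled *)

(** No edge reaches [n] or beyond, so [n] can serve as a fresh vertex in each operation. *)
Definition wf_adj (n : nat) (adj : rel nat) : Prop :=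
  symmetric adj /\ forall x y, adj x y -> x < n.

Lemma wf_fresh n adj : wf_adj n adj -> forall x y, n <= y -> adj x y = false.
Proof.
move=> [sym lt] x y; rewrite leqNgt; apply: contraNF; rewrite sym; exact: lt.
Qed.

Lemma wf_add n adj v : wf_adj n adj -> v < n -> wf_adj n.+1 (add_edge adj v n).
Proof.
move=> [sym lt] vn; split=> [x y|x y]; rewrite /add_edge.
  by rewrite sym -!orbA; congr (_ || _); rewrite orbC; congr (_ || _); rewrite andbC.
by case/orP=> [/orP[/lt|/andP[/eqP->]]|/andP[/eqP->]] //; lia.
Qed.

Lemma ndeg_add n adj v x : wf_adj n adj -> v < n -> x <= n ->
  ndeg n.+1 (add_edge adj v n) x = if x == n then 1 else ndeg n adj x + (x == v).
Proof.
move=> wf vn xn; rewrite /ndeg -addn1 iotaD count_cat /= add0n addn0.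
have wfx := wf_fresh wf; have adjC : symmetric adj by case: wf.
have -> : add_edge adj v n x n = (x == v).
  by rewrite /add_edge wfx // eqxx andbT [n == v]gtn_eqF // andbF orbF.
have [->|nxn] := eqVneq x n.
  rewrite [n == v]gtn_eqF // /= addn0.
  have -> : count (add_edge adj v n n) (iota 0 n) = count (pred1 v) (iota 0 n).
    apply: eq_in_count => y; rewrite mem_iota add0n => yn.
    by rewrite /add_edge adjC wfx // [y == n]ltn_eqF // andbF /= eqxx.
  by rewrite count_uniq_mem ?iota_uniq // mem_iota leq0n add0n vn.
congr (_ + _); apply: eq_in_count => y; rewrite mem_iota add0n => yn.
by rewrite /add_edge (negPf nxn) [y == n]ltn_eqF // !andbF !orbF.
Qed.

Lemma ndeg2_neighbor n adj x a b w : wf_adj n adj -> ndeg n adj x = 2 ->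
  adj x a -> adj x b -> a != b -> adj x w -> w = a \/ w = b.
Proof.
move=> wf dx xa xb nab xw; have wfx := wf_fresh wf.
have [->|nwa] := eqVneq w a; first by left.
have [->|nwb] := eqVneq w b; first by right.
suff : 3 <= ndeg n adj x by rewrite dx.
rewrite /ndeg -size_filter; apply: (@uniq_leq_size _ [:: w; a; b]).
  by rewrite /= !inE negb_or nwa nwb nab.
have inN y : adj x y -> y \in [seq z <- iota 0 n | adj x z].
  move=> xy; rewrite mem_filter xy mem_iota /= add0n ltnNge.
  by apply: contraTN xy => ny; rewrite wfx.
by move=> y; rewrite !inE => /or3P[] /eqP ->; apply: inN.
Qed.

(* Labels record the position of a vertex in its piece; the pieces are what is
   left of the labelled tree once the edges joining two ends are erased. *)
Definition labelled_piece n adj (lab : nat -> status) (s : seq nat) : Prop :=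
  good_piece_for adj (ndeg n adj) s /\
  (map lab s = [:: SA; SC] \/ map lab s = [:: SA; SC; SD; SB]).

Definition labelled_tiling n adj lab (L : seq (seq nat)) : Prop :=
  [/\ uniq (flatten L), flatten L =i iota 0 n &
      forall s, s \in L -> labelled_piece n adj lab s].

(** The path found by an operation is a whole piece: the label D places [d] third in a path piece,
    and since [d] and [c] have degree 2 with both neighbours in that piece, the labels leave only
    one way to read it. *)
Lemma ind_path_piece n adj lab L a c d b :
  wf_adj n adj -> labelled_tiling n adj lab L ->
  ind_path4 n adj a c d b -> lab a = SA -> lab c = SC -> lab d = SD -> lab b = SB ->
  [:: a; c; d; b] \in L.
Proof.
move=> wf [UL LT pL] [[an cn dn bn _] [[ac cd db] _]] la lc ld lb.
have adjC : symmetric adj by case: wf.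
have /flattenP[s sL ds] : d \in flatten L by rewrite LT mem_iota.
have Us := uniq_flatten_sub UL sL.
have [gs ls] := pL s sL.
case: s gs ls ds Us sL => [|a' [|c' [|d' [|b' []]]]] //=.
  move=> _ [] // [la' lc']; rewrite !inE => /orP[] /eqP E; rewrite E in ld; congruence.
case/and5P=> /and3P[ac' cd' db'] /eqP dc' /eqP dd' _ _ [] // [la' lc' ld' lb'] ds Us sL.
have {ds} E : d = d' by move: ds; rewrite !inE => /or4P[] /eqP // E; rewrite E in ld;
  congruence.
subst d'; move: Us; rewrite !inE !negb_or => /and4P[/and3P[nac nad nab] /andP[ncd ncb]
  ndb _].
have dc : adj d c by rewrite adjC.
have dc'' : adj d c' by rewrite adjC.
have [Ec|Ec] := ndeg2_neighbor wf dd' dc'' db' ncb dc; last by rewrite Ec lb' in lc.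
have [Eb|Eb] := ndeg2_neighbor wf dd' dc'' db' ncb db; first by rewrite Eb lc' in lb.
subst c' b'; have ca : adj c a by rewrite adjC.
have ca' : adj c a' by rewrite adjC.
have [Ea|Ea] := ndeg2_neighbor wf dc' ca' cd nad ca; last by rewrite Ea ld in la.
by rewrite Ea.
Qed.

Lemma labelled_piece_eq n (adj : rel nat) lab n' (adj' : rel nat) lab' (s : seq nat) :
  (forall x y, adj x y -> adj' x y) ->
  {in s, forall x, ndeg n' adj' x = ndeg n adj x /\ lab' x = lab x} ->
  labelled_piece n adj lab s -> labelled_piece n' adj' lab' s.
Proof.
move=> sub eqs [gs ls]; split; last first.
  by rewrite (_ : map lab' s = map lab s) //; apply/eq_in_map => x /eqs[].
case: s gs ls eqs => [|a [|c [|d [|b []]]]] //= gs _ eqs.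
  by case/and3P: gs => ac da dc; rewrite sub ?ac // !(proj1 (eqs _ _)) ?inE ?eqxx ?orbT
    ?da.
have [[Ea _] [Ec _]] : (ndeg n' adj' a = ndeg n adj a /\ lab' a = lab a) /\
    (ndeg n' adj' c = ndeg n adj c /\ lab' c = lab c).
  by split; apply: eqs; rewrite !inE eqxx ?orbT.
have [[Ed _] [Eb _]] : (ndeg n' adj' d = ndeg n adj d /\ lab' d = lab d) /\
    (ndeg n' adj' b = ndeg n adj b /\ lab' b = lab b).
  by split; apply: eqs; rewrite !inE eqxx ?orbT.
by case/and5P: gs => /and3P[/sub-> /sub-> /sub->]; rewrite Ea Eb Ec Ed => -> -> -> ->.
Qed.

Lemma wf_inT2 n adj lab : inT2 n adj lab -> wf_adj n adj.
Proof.
elim=> {n adj lab} [|n adj lab v _ wf vn _ _|n adj lab v _ wf vn _ _|n adj lab v _ wf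
  vn _ _ _].
- by rewrite /p4_adj; do 3 (apply: wf_add => //); split.
- by do 2 (apply: wf_add => //).
- by do 4 (apply: wf_add => //).
- by do 2 (apply: wf_add => //).
Qed.

Lemma ndeg_pendant n adj v x : wf_adj n adj -> v < n -> x <= n.+1 ->
  ndeg n.+2 (add_edge (add_edge adj v n) n n.+1) x =
  if x == n.+1 then 1 else
  (if x == n then 1 else ndeg n adj x + (x == v)) + (x == n).
Proof.
move=> wf vn xn; have wf1 := wf_add wf vn.
rewrite (ndeg_add wf1 (ltnSn n)) //; case: eqP => // nx.
by rewrite ndeg_add //; lia.
Qed.

(** Only the degree of [v] grows; the piece stays good because its opposite end has degree 2, as the
    corresponding vertex in O2 and O4 guarantees. *)
Lemma piece_pendant n adj lab v a c d b :
  wf_adj n adj -> v < n -> uniq [:: a; c; d; b] -> all (ltn^~ n) [:: a; c; d; b] ->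
  labelled_piece n adj lab [:: a; c; d; b] ->
  v = b /\ ndeg n adj a = 2 \/ v = a /\ ndeg n adj b = 2 ->
  labelled_piece n.+2 (add_edge (add_edge adj v n) n n.+1)
    (upd (upd lab n SA) n.+1 SC) [:: a; c; d; b].
Proof.
move=> wf vn; rewrite /= !inE !negb_or => /and4P[/and3P[nac nad nab] /andP[ncd ncb] ndb
  _].
case/and5P=> an cn dn bn _ [/= gs ls] vab.
have old x : x < n -> ((x == n) = false) * ((x == n.+1) = false) by move=> xn; split; lia.
split; last by rewrite /= /upd !old.
case/and5P: gs => /and3P[ac cd db] dc dd /andP[da db'] _.
have sub x y : adj x y -> add_edge (add_edge adj v n) n n.+1 x y.
  by move=> xy; rewrite /add_edge xy.
have dg x : x < n -> ndeg n.+2 (add_edge (add_edge adj v n) n n.+1) x =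
    ndeg n adj x + (x == v).
  by move=> xn; rewrite ndeg_pendant ?old ?addn0 //; lia.
rewrite /= !sub // !dg //.
case: vab => -[-> E]; rewrite E eqxx (eqP dc) (eqP dd).
  by rewrite (negPf nab) (negPf ncb) (negPf ndb) !addn0 /=; lia.
by rewrite ![_ == a]eq_sym (negPf nab) (negPf nac) (negPf nad) !addn0 orbT /=; lia.
Qed.

Lemma tiling_pendant n adj lab L v s :
  wf_adj n adj -> labelled_tiling n adj lab L -> v < n -> v \in s -> s \in L ->
  labelled_piece n.+2 (add_edge (add_edge adj v n) n n.+1)
    (upd (upd lab n SA) n.+1 SC) s ->
  labelled_tiling n.+2 (add_edge (add_edge adj v n) n n.+1)
    (upd (upd lab n SA) n.+1 SC) ([:: n; n.+1] :: L).
Proof.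
move=> wf [UL LT pL] vn vs sL ps'.
have deg2 := ndeg_pendant wf vn.
have Ln x : x \in flatten L -> x < n by rewrite LT mem_iota.
split.
- rewrite /= UL !inE andbT; apply/andP; split.
    by rewrite ltn_eqF //=; apply/negP => /Ln; rewrite ltnn.
  by apply/negP => /Ln; lia.
- by move=> x; rewrite /= !inE LT !mem_iota; lia.
- move=> s'; rewrite inE => /predU1P[->|s'L].
    split; last first.
      by left; rewrite /= /upd !eqxx [n == n.+1]ltn_eqF.
    by rewrite /= !deg2 ?eqxx ?[n == n.+1]ltn_eqF //= /add_edge !eqxx !orbT.
  have [->//|nss'] := eqVneq s' s.
  apply: labelled_piece_eq (pL s' s'L).
    by move=> x y xy; rewrite /add_edge xy.
  move=> x xs'; have xn : x < n by apply: Ln; apply/flattenP; exists s'.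
  have xn1 : x < n.+1 by apply: ltnW.
  rewrite deg2 /upd; last exact: ltnW.
  rewrite (ltn_eqF xn) (ltn_eqF xn1) /=.
  have -> : x == v = false; last by rewrite !addn0.
  by apply: contraNF nss' => /eqP xv; apply/eqP/(uniq_flatten_mem UL s'L sL xs');
    rewrite xv.
Qed.

Lemma inT2_tiling n adj lab : inT2 n adj lab -> exists L, labelled_tiling n adj lab L.
Proof.
elim=> {n adj lab}.
- exists [:: [:: 1; 0]; [:: 2; 3]]; split=> //.
    by move=> x; rewrite /= !inE; lia.
  by move=> s; rewrite !inE => /orP[] /eqP->; split=> //; left.
- move=> n adj lab v T [L tL] vn lv [u [un [[_ [c [d [P [lu [lc ld]]]]]] du]]].
  have wf := wf_inT2 T; have sL := ind_path_piece wf tL P lu lc ld lv.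
  have [UL LT pL] := tL.
  exists ([:: n; n.+1] :: L); apply: (tiling_pendant wf tL vn _ sL).
    by rewrite !inE eqxx !orbT.
  apply: piece_pendant => //; [exact: uniq_flatten_sub UL sL| |exact: pL|by left].
  by case: P => -[*]; apply/and5P.
- move=> n adj lab v T [L tL] vn lv dv; have [UL LT pL] := tL.
  have wf := wf_inT2 T.
  have /flattenP[s sL vs] : v \in flatten L by rewrite LT mem_iota.
  (* The inner [c] of a path piece has degree 2, so a vertex labelled C of degree 1 can only be the
     leaf of a pair. *)
  have [a Es] : exists a, s = [:: a; v].
    have [gs ls] := pL s sL; case: s gs ls vs {sL} => [|a [|c [|d [|b []]]]] //=.
      move=> _ [] // [la lc]; rewrite !inE => /orP[] /eqP E; last by exists a; rewrite E.
      by rewrite E la in lv.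
    case/and5P=> _ /eqP dc _ _ _ [] // [la lc ld lb].
    by rewrite !inE => /or4P[] /eqP E; move: lv dv; rewrite E ?la ?ld ?lb ?dc.
  subst s; have pL' := perm_to_rem sL.
  have {pL'} := perm_flatten pL'; set L' := rem _ _ => pL'.
  have UL' : uniq ([:: a; v] ++ flatten L') by rewrite -(perm_uniq pL').
  have LT' x : x \in [:: a; v] ++ flatten L' = (x < n).
    by rewrite -(perm_mem pL') LT mem_iota.
  have [/= /and3P[aav /eqP da _] [[la _]|//]] := pL _ sL.
  have wf1 := wf_add wf vn; have wf2 := wf_add wf1 (ltnSn n).
  have dg x : x <= n.+3 -> ndeg n.+4 (add_edge (add_edge
       (add_edge (add_edge adj v n) n n.+1) n.+1 n.+2) n.+2 n.+3) x =
     if x == n.+3 then 1 else if x < n then ndeg n adj x + (x == v) else 2.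
    move=> xn; rewrite (ndeg_pendant wf2 (ltnSn _)) //.
    case: (x =P n.+3) => // nx3; case: (x =P n.+2) => [->|nx2];
      first by rewrite ltnNge ltnW.
    rewrite ndeg_pendant //; last lia.
    case: (x =P n.+1) => [->|nx1]; first by rewrite ltnNge ltnW.
    case: (x =P n) => [->|nx0]; first by rewrite ltnn.
    by rewrite !addn0; case: ltnP => //; lia.
  have av : a < n /\ a != v.
    split; first by rewrite -LT' inE eqxx.
    by move: UL'; rewrite /= !inE negb_or => /andP[/andP[]].
  have [an nav] := av.
  have nL' x : x \in flatten L' -> [/\ x < n, x != a & x != v].
    move=> xL'; rewrite -LT' mem_cat xL' orbT.
    by split=> //; apply: contraTneq UL' => <-; rewrite /= ?inE xL' ?orbT ?andbF.
  have ge_nL' x : n <= x -> x \in flatten L' = false.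
    by move=> nx; apply/negP => /nL' []; rewrite ltnNge nx.
  have old x : x < n -> ((x == n) = false) * ((x == n.+1) = false) *
      ((x == n.+2) = false) * ((x == n.+3) = false) by move=> xn; do !split; lia.
  have new : ((n == n.+1) = false) * ((n == n.+2) = false) * ((n == n.+3) = false) *
      ((n.+1 == n.+2) = false) * ((n.+1 == n.+3) = false) * ((n.+2 == n.+3) = false).
    by do !split; lia.
  set d' := ndeg _ _ in dg.
  have degs : (d' a = 2) * (d' v = 2) * (d' n = 2) * (d' n.+1 = 2) *
      (d' n.+2 = 2) * (d' n.+3 = 1).
    do !split; rewrite dg ?eqxx ?new ?old ?ltnn //; try lia.
    - by rewrite an da (negPf nav).
    - by rewrite vn dv.
    - by rewrite ltnNge leqnSn.
    - by rewrite ltnNge ltnW.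
  (* O3 prolongs the pair [[a v]] to a path and adds a new pair; [a] keeps its degree 2. *)
  exists ([:: a; v; n; n.+1] :: [:: n.+2; n.+3] :: L'); split.
  - have aL' : a \in flatten L' = false by apply/negP => /nL' []; rewrite eqxx.
    have vL' : v \in flatten L' = false by apply/negP => /nL' []; rewrite eqxx.
    have uL' : uniq (flatten L') by case/andP: UL' => _ /andP[].
    by rewrite /= !inE aL' vL' !ge_nL' ?uL' //; lia.
  - by move=> x; have := LT' x; rewrite /= !inE mem_iota; case: (x \in flatten L'); lia.
  - move=> s; rewrite !inE => /or3P[/eqP->|/eqP->|sL'].
    + split; last by right; rewrite /= /upd !eqxx !new !(old _ an) !(old _ vn) la lv.
      rewrite /= -/d' !degs /add_edge aav !eqxx !orbT //.
    + split; last by left; rewrite /= /upd !eqxx !new.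
      by rewrite /= -/d' !degs /add_edge !eqxx !orbT.
    + have sL0 : s \in L by apply: mem_rem sL'.
      apply: labelled_piece_eq (pL s sL0); first by move=> x y xy; rewrite /add_edge xy.
      move=> x xs; have /nL'[xn nxa nxv] : x \in flatten L' by apply/flattenP; exists s.
      have xn3 : x <= n.+3 by lia.
      by rewrite -/d' dg // /upd !(old _ xn) xn (negPf nxv) addn0.
- move=> n adj lab v T [L tL] vn _ lv [u [un [[_ [_ [_ [c [d [P [lc [ld lu]]]]]]]] du]]].
  have wf := wf_inT2 T; have sL := ind_path_piece wf tL P lv lc ld lu.
  have [UL LT pL] := tL.
  exists ([:: n; n.+1] :: L); apply: (tiling_pendant wf tL vn _ sL).
    by rewrite !inE eqxx.
  apply: piece_pendant => //; [exact: uniq_flatten_sub UL sL| |exact: pL|by right].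
  by case: P => -[*]; apply/and5P.
Qed.

Lemma has_T2_labeling_tiled (V : finType) (e : rel V) :
  has_T2_labeling e -> tiled e setT.
Proof.
move=> [n [adj [lab [T [f [fn fI fS fE]]]]]]; have [L [UL LT pL]] := inT2_tiling T.
have n0 : 0 < n by elim: T.
have [x0 _] := fS 0 n0.
(* The inverse of [f]; the default [x0] can only occur for numbers not below [n]. *)
pose g k := odflt x0 [pick x | f x == k].
have gK k : k < n -> f (g k) = k.
  move=> /fS[x fx]; rewrite /g; case: pickP => [y /eqP //|/(_ x)].
  by rewrite fx eqxx.
have fK : cancel f g by move=> x; apply: fI; apply: gK.
have degE k : k < n -> deg e (g k) = ndeg n adj k.
  move=> kn; rewrite /deg /ndeg -[in RHS](gK k kn).
  have /permP-> : perm_eq (iota 0 n) [seq f x | x <- enum V].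
    apply: uniq_perm; rewrite ?iota_uniq //; first by rewrite map_inj_uniq ?enum_uniq.
    move=> y; rewrite mem_iota /= add0n; apply/idP/mapP => [/fS[x <-]|[x _ ->//]].
    by exists x; rewrite ?mem_enum.
  rewrite count_map cardE -size_filter; apply: perm_size.
  apply: uniq_perm; [exact: enum_uniq | by rewrite filter_uniq ?enum_uniq |] => x.
  by rewrite mem_enum inE mem_filter mem_enum /= fE andbT.
have Ln s x : s \in L -> x \in s -> x < n.
  by move=> sL xs; move: (LT x); rewrite mem_iota /= add0n => <-; apply/flattenP;
    exists s.
have gI : {in flatten L &, injective g}.
  by move=> x y; rewrite !LT !mem_iota !add0n => /gK xK /gK yK E; rewrite -xK E yK.
exists (map (map g) L); rewrite -map_flatten; split.
- apply/allP => _ /mapP[s sL ->]; have [gs _] := pL s sL; have lt := Ln s _ sL.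
  case: s gs sL lt => [|a [|c [|d [|b []]]]] //= gs sL lt.
    by rewrite /good_piece /= fE !gK ?degE ?lt // !inE eqxx ?orbT.
  by rewrite /good_piece /= !fE !gK ?degE ?lt // !inE eqxx ?orbT.
- by rewrite map_inj_in_uniq.
- move=> x; rewrite inE; apply/mapP; exists (f x); last by rewrite fK.
  by rewrite LT mem_iota fn.
Qed.

(** * Tiled trees belong to the family T2 *)

Section Oriented.
Variables (V : finType) (e : rel V).
Hypothesis treeV : is_tree e.
Implicit Types (S : {set V}) (s t : seq V) (x y a b c d : V).
Let esym : symmetric e. Proof. by case: treeV => [[]]. Qed.
Let eirr : irreflexive e. Proof. by case: treeV => [[]]. Qed.

Variable L : seq (seq V).
Hypotheses (goodL : all (good_piece e) L) (uniqL : uniq (flatten L)).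
Hypothesis fullL : flatten L =i [set: V].

(* A path piece may be entered from either end, and is labelled A, C, D, B from the
   end where it is entered. *)
Definition oriented s : bool := (s \in L) || (size s == 4) && (rev s \in L).

Lemma good_piece_rev s : size s = 4 -> good_piece e (rev s) = good_piece e s.
Proof.
case: s => [|a [|c [|d [|b []]]]] // _; rewrite /good_piece /= [e d c]esym [e b d]esym
  [e c a]esym.
by case: (e a c); case: (e c d); case: (e d b); lia.
Qed.

Lemma oriented_good s : oriented s -> good_piece e s.
Proof.
case/orP=> [/(allP goodL) //|/andP[/eqP s4 sL]].
by rewrite -good_piece_rev // (allP goodL).
Qed.

Lemma oriented_uniq s : oriented s -> uniq s.
Proof.
case/orP=> [|/andP[_]] /(uniq_flatten_sub uniqL) //.
by rewrite rev_uniq.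
Qed.

Lemma oriented_rev s : size s = 4 -> oriented (rev s) = oriented s.
Proof. by move=> s4; rewrite /oriented size_rev s4 revK eqxx orbC. Qed.

Lemma oriented_same s s' x : oriented s -> oriented s' -> x \in s -> x \in s' ->
  s' = s \/ size s = 4 /\ s' = rev s.
Proof.
move=> + + xs xs'; have same := uniq_flatten_mem uniqL.
case/orP=> [sL|/andP[/eqP s4 sL]]; case/orP=> [sL'|/andP[/eqP s4' sL']].
- by left; apply: same sL' sL xs' xs.
- have E : rev s' = s by apply: (same _ _ x); rewrite ?mem_rev.
  by right; rewrite -E revK size_rev.
- have E : rev s = s' by apply: (same _ _ x); rewrite ?mem_rev.
  by right; rewrite E.
- have E : rev s = rev s' by apply: (same _ _ x); rewrite ?mem_rev.
  by left; rewrite -[s]revK E revK.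
Qed.

Lemma oriented_mem s s' x : oriented s -> oriented s' -> x \in s -> x \in s' -> s =i s'.
Proof.
move=> os os' xs xs'; case: (oriented_same os os' xs xs') => [->|[_ ->]] // y.
by rewrite mem_rev.
Qed.

(** Reading a path from its nearer end puts any of its vertices first or second. So first place
    characterises ends, and second place inner vertices, including the leaf of a pair. *)
Lemma oriented_cases x : (exists c t, oriented [:: x, c & t]) \/ (exists a t, oriented
  [:: a, x & t]).
Proof.
have /flattenP[s sL xs] : x \in flatten L by rewrite fullL inE.
have os : oriented s by rewrite /oriented sL.
have := oriented_good os; case: s os xs {sL} => [|a [|c [|d [|b []]]]] // os;
  rewrite !inE.
  by case/orP=> /eqP-> _; [left; exists c, [::] | right; exists a, [::]].
have os' : oriented [:: b; d; c; a] by rewrite -oriented_rev.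
case/or4P=> /eqP-> _.
- by left; exists c, [:: d; b].
- by right; exists a, [:: d; b].
- by right; exists b, [:: c; a].
- by left; exists d, [:: c; a].
Qed.

Lemma inner_neighbor a i t w : oriented [:: a, i & t] -> e i w -> w \in [:: a, i & t].
Proof.
move=> os eiw; have := oriented_good os; have := oriented_uniq os.
case: t os => [|d [|b []]] // os; rewrite /= !inE.
  move=> _ /and3P[eai _ li]; have eia : e i a by rewrite esym.
  by rewrite (leaf_neighbor li eiw eia) eqxx.
rewrite !negb_or => /and4P[/and3P[_ nad _] _ _ _].
case/and5P=> /and3P[eai eid _] /eqP di _ _ _.
have eia : e i a by rewrite esym.
by have [->|->] := deg2_neighbor di eia eid nad eiw; rewrite eqxx ?orbT.
Qed.

(** If [y] were inner, all its neighbours, [x] among them, would lie in its own piece, which would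
    then be the piece of [x]. *)
Lemma end_neighbor x t y : oriented (x :: t) -> e x y -> y \notin x :: t ->
  exists c t', oriented [:: y, c & t'].
Proof.
move=> os exy ny; have [//|[a [t' os']]] := oriented_cases y.
have xs' : x \in [:: a, y & t'] by apply: (inner_neighbor os'); rewrite esym.
have := oriented_mem os os' (mem_head _ _) xs' y.
by rewrite (negPf ny) !inE eqxx orbT.
Qed.

Lemma oriented_end_inner x t a t' : oriented (x :: t) -> oriented [:: a, x & t'] -> False.
Proof.
move=> os os'; have := oriented_uniq os'; have := oriented_good os.
case: (oriented_same os' os (x := x)); rewrite ?inE ?eqxx ?orbT //.
  by case=> -> _; rewrite /= inE eqxx.
case=> s4; case: t' s4 {os'} => [|d [|b []]] // _; rewrite /rev /= => -[-> _] _.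
by rewrite !inE eqxx !orbT andbF.
Qed.

Lemma end_edge_off x t y t' : oriented (x :: t) -> oriented (y :: t') -> e x y ->
  y \notin x :: t.
Proof.
move=> os os' exy; apply/negP => ys.
case: (oriented_same os os' ys (mem_head _ _)) => [[yx _]|[]].
  by rewrite yx eirr in exy.
case: t os ys => [|c [|d [|b []]]] // os ys _ /=; rewrite /rev /= => -[E _].
have := oriented_uniq os; have := oriented_good os.
case/and5P=> /and3P[exc ecd edb] _ _ _ _; rewrite /= !inE !negb_or.
case/and4P=> /and3P[_ nxd _] /andP[_ ncb] _ _.
by rewrite E (square_free treeV exc ecd edb) in exy.
Qed.

(* Leave a leaf through its support vertex; as long as the next end has degree at
   least 3, the other end of its piece has degree 2 and the walk goes on there. *)
Lemma exists_basic_edge : 1 < #|V| -> exists x c t y c' t',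
  [/\ oriented [:: x, c & t], oriented [:: y, c' & t'], e x y, deg e x = 2 & deg e y = 2].
Proof.
move=> V1.
have walk n S x p t : #|S| < n -> oriented [:: x, p & t] -> deg e x = 2 -> branch e S x
  p ->
    exists x c t y c' t',
  [/\ oriented [:: x, c & t], oriented [:: y, c' & t'], e x y, deg e x = 2 & deg e y = 2].
  elim: n S x p t => // n IHn S x p t leSn os dx BS; have [PS _] := BS.
  have [xS pS exp _] := PS.
  have [y] : exists y, y \in [set y in S | e x y].
    by apply/set0Pn; rewrite -card_gt0 -/(nb e S x); move: (branch_deg BS); lia.
  rewrite inE => /andP[yS exy].
  have nys : y \notin [:: x, p & t].
    have [[c [t' os']]|[a [t' os']]] := oriented_cases y.
      exact: end_edge_off os os' exy.
    have xs' : x \in [:: a, y & t'] by apply: (inner_neighbor os'); rewrite esym.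
    have npy : p != y by apply: contraNneq pS => ->.
    case: (oriented_same os os' (mem_head _ _) xs') => [[_ yp]|[s4 E]].
      by rewrite yp eqxx in npy.
    case: t os s4 E => [|d [|b []]] // os _; rewrite /rev /= => -[_ yd _].
    have /and5P[/and3P[_ epd _] _ _ _ _] := oriented_good os.
    by move: exy; rewrite yd (triangle_free treeV exp epd).
  have [c [t' os']] := end_neighbor os exy nys.
  have [dy|dy] := eqVneq (deg e y) 2; first by exists x, p, t, y, c, t'.
  have := oriented_uniq os'; have := oriented_good os'.
  case: t' os' => [|d [|b []]] // os'; first by case/and3P=> _ /eqP dy2;
    rewrite dy2 in dy.
  case/and5P=> /and3P[eyc ecd edb] _ _ _ db; rewrite /= !inE !negb_or.
  case/and4P=> /and3P[_ nyd _] /andP[_ ncb] _ _.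
  have [xA BA] := branch_away treeV exy; have [AS _] := plant_split treeV PS yS exy.
  have nxs' : x \notin [:: y; c; d; b].
    apply: contra nys => xs'.
    by rewrite (oriented_mem os os' (mem_head _ _) xs') mem_head.
  have [PA nA] := BA.
  have cA : c \in away e x y.
    by case/orP: (nA c eyc) => // /eqP cx; move: nxs'; rewrite -cx !inE eqxx orbT.
  have [AA _] := plant_split treeV PA cA eyc; have [yA' BA'] := branch_away treeV eyc.
  have [PA' nA'] := BA'.
  have dA : d \in away e y c.
    by case/orP: (nA' d ecd) => // /eqP dy'; rewrite dy' eqxx in nyd.
  have [AA' _] := plant_split treeV PA' dA ecd; have [cA' BA''] := branch_away treeV ecd.
  have [PA'' nA''] := BA''.
  have bA : b \in away e c d.
    by case/orP: (nA'' b edb) => // /eqP bc; rewrite bc eqxx in ncb.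
  have [AA'' _] := plant_split treeV PA'' bA edb; have [_ Bb] := branch_away treeV edb.
  (* The walk crosses the piece of [y] to its other end [b], of degree 2 because [y] has another
     degree; the branch beyond [b] no longer contains [x]. *)
  apply: (IHn (away e d b) b d [:: c; y]) => //.
  - rewrite -ltnS (leq_trans _ leSn) // ltnS proper_card //; apply/properP; split.
      by do 3 (apply: subset_trans; first eassumption).
    exists x => //; apply: contra xA => xb.
    by apply/(subsetP AA)/(subsetP AA')/(subsetP AA'').
  - by rewrite -oriented_rev.
  - by move: db; rewrite (negPf dy) => /eqP.
have [z lz] := tree_leaf treeV V1.
have [a [t os]] : exists a t, oriented [:: a, z & t].
  have [[c [t os]]|//] := oriented_cases z; exfalso.
  have := oriented_good os; case: t os => [|d [|b []]] // _;
    rewrite /good_piece /= (eqP lz).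
    by rewrite andbF.
  by rewrite !andbF.
have := oriented_good os; case: t os => [|d [|b []]] // os; last first.
  by rewrite /good_piece /= (eqP lz) !andbF.
case/and3P=> eaz /eqP da _; have eza : e z a by rewrite esym.
have [_ B] := branch_away treeV eza.
exact: (walk _ _ _ _ _ (ltnSn _) os da B).
Qed.

End Oriented.

(** * Numbering a connected part of the tree *)

Section Embedding.
Variables (V : finType) (e : rel V).
Hypothesis treeV : is_tree e.
Implicit Types (S : {set V}) (x y z : V) (f : V -> nat) (adj : rel nat).
Let esym : symmetric e. Proof. by case: treeV => [[]]. Qed.
Let eirr : irreflexive e. Proof. by case: treeV => [[]]. Qed.

Definition connected S : Prop := {in S &, forall x y, connect (erel e (fun z =>
  z \in S)) x y}.

Lemma connected1 x : connected [set x].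
Proof. by move=> y z; rewrite !inE => /eqP-> /eqP->. Qed.

Lemma connected_add S x y : connected S -> x \in S -> e x y -> connected (y |: S).
Proof.
move=> cS xS exy.
have sub u v : u \in S -> v \in S -> connect (erel e (fun z => z \in y |: S)) u v.
  move=> uS vS; apply: connect_sub (cS u v uS vS) => a b /and3P[/= aS bS eab].
  by apply/connect1/and3P; split; rewrite // inE ?aS ?bS orbT.
have xy : connect (erel e (fun z => z \in y |: S)) x y.
  by apply/connect1/and3P; split; rewrite // !inE ?eqxx ?xS ?orbT.
have yx : connect (erel e (fun z => z \in y |: S)) y x.
  by apply/connect1/and3P; split; rewrite ?inE ?eqxx ?xS ?orbT // esym.
move=> u v; rewrite !inE => /predU1P[->|uS] /predU1P[->|vS]; rewrite ?connect0 //.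
- exact: (connect_trans yx (sub _ _ xS vS)).
- exact: (connect_trans (sub _ _ uS xS) xy).
- exact: sub.
Qed.

Lemma connected_unique S x x' y : connected S -> y \notin S -> x \in S -> x' \in S ->
  e y x -> e y x' -> x = x'.
Proof.
move=> cS yS xS xS'; exact: (unique_neighbor treeV (P := fun z =>
  z \in S)) yS xS (cS _ _ xS xS').
Qed.

Definition embedded S (n : nat) adj f : Prop :=
  [/\ wf_adj n adj, perm_eq [seq f x | x <- enum S] (iota 0 n) &
      {in S &, forall x y, adj (f x) (f y) = e x y}].

Section Facts.
Variables (S : {set V}) (n : nat) (adj : rel nat) (f : V -> nat).
Hypothesis emb : embedded S n adj f.

Lemma embedded_lt x : x \in S -> f x < n.
Proof.
case: emb => _ /perm_mem fS _ xS; move: (fS (f x)).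
by rewrite mem_iota /= add0n => <-; apply: map_f; rewrite mem_enum.
Qed.

Lemma embedded_onto k : k < n -> exists2 x, x \in S & f x = k.
Proof.
case: emb => _ /perm_mem fS _ kn; move: (fS k); rewrite mem_iota /= add0n kn.
by case/mapP=> x; rewrite mem_enum => xS ->; exists x.
Qed.

Lemma embedded_inj : {in S &, injective f}.
Proof.
case: emb => _ /perm_uniq; rewrite iota_uniq => Uf _ x y xS yS fxy.
have xE : x \in enum S by rewrite mem_enum.
have yE : y \in enum S by rewrite mem_enum.
have /(uniqP 0) inj := Uf.
have : index x (enum S) = index y (enum S).
  apply: inj; rewrite ?inE ?size_map ?index_mem //.
  by rewrite !(nth_map x) ?index_mem // !nth_index.
by move=> E; rewrite -[x](nth_index x xE) E nth_index.
Qed.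

Lemma embedded_deg x : x \in S -> ndeg n adj (f x) = nb e S x.
Proof.
case: emb => _ /permP fS fE xS; rewrite /ndeg -fS count_map /nb cardE -size_filter.
apply: perm_size; apply: uniq_perm; [by rewrite filter_uniq ?enum_uniq | exact:
  enum_uniq |].
move=> y; rewrite mem_filter !mem_enum in_set /= andbC.
by case yS : (y \in S); rewrite //= fE.
Qed.

(** As [S] is connected and the tree acyclic, [x] is the only neighbour of [y] in [S], so one
    pendant edge is the whole new adjacency. *)
Lemma embedded_add x y : connected S -> x \in S -> y \notin S -> e x y ->
  embedded (y |: S) n.+1 (add_edge adj (f x) n) (fun z => if z == y then n else f z).
Proof.
move=> cS xS yS exy; have [wf fS fE] := emb.
have nS z : z \in S -> (z == y) = false by move=> zS; apply: contraNF yS => /eqP <-.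
split; first by apply: wf_add => //; apply: embedded_lt.
  have -> : iota 0 n.+1 = rcons (iota 0 n) n by rewrite -addn1 iotaD cats1.
  rewrite perm_sym perm_rcons perm_sym.
  have /(perm_map (fun z => if z == y then n else f z))/permPl-> :
      perm_eq (enum (y |: S)) (y :: enum S).
    apply: uniq_perm; rewrite ?enum_uniq //=; first by rewrite mem_enum yS enum_uniq.
    by move=> z; rewrite inE !mem_enum !inE.
  rewrite /= eqxx perm_cons (_ : map _ _ = map f (enum S)) //.
  by apply/eq_in_map => z; rewrite mem_enum => /nS->.
have wfn := wf_fresh wf; have adjC : symmetric adj by case: wf.
have lt := embedded_lt.
have iff z : z \in S -> (f z == f x) = e z y.
  move=> zS; apply/eqP/idP => [/embedded_inj-> //|ezy].
  by congr f; apply: (connected_unique cS yS zS xS); rewrite esym.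
move=> u v; rewrite !inE => /predU1P[->|uS] /predU1P[->|vS];
  rewrite /add_edge ?eqxx ?nS //.
- by rewrite wfn // eirr [n == f x]gtn_eqF ?lt // andbF.
- by rewrite adjC wfn // [n == f x]gtn_eqF ?lt //= iff // esym.
- by rewrite wfn // [n == f x]gtn_eqF ?lt // andbT andbF orbF iff.
- by rewrite fE // !(ltn_eqF (lt _ _)) // !andbF /= !orbF.
Qed.

End Facts.
End Embedding.

(** * Enlarging a partially built labelled tree *)

Section Growth.
Variables (V : finType) (e : rel V).
Hypothesis treeV : is_tree e.
Implicit Types (S : {set V}) (s t : seq V) (x y z a b c d : V).
Implicit Types (n : nat) (adj : rel nat) (lab : nat -> status) (f : V -> nat).
Let esym : symmetric e. Proof. by case: treeV => [[]]. Qed.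

Variable L : seq (seq V).
Hypotheses (goodL : all (good_piece e) L) (uniqL : uniq (flatten L)).
Local Notation oriented := (oriented L).

Definition fully_placed S lab f s : Prop :=
  {subset s <= S} /\
  (map (lab \o f) s = [:: SA; SC] \/ map (lab \o f) s = [:: SA; SC; SD; SB]).

Definition half_placed S lab f s : Prop :=
  exists a c d b, [/\ s = [:: a; c; d; b], (a \in S) && (c \in S),
    (d \notin S) && (b \notin S), lab (f a) = SA & lab (f c) = SC].

(** [3 < n] keeps new vertices off the basic path. The fourth clause fixes degree 2 in the whole
    tree for the basic vertices labelled A, so O4 is never wanted where it is forbidden. *)
Definition partial S n adj lab f : Prop :=
  [/\ embedded e S n adj f, connected e S, 3 < n,
      forall x, x \in S -> lab (f x) = SA -> f x < 4 -> deg e x = 2 &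
      forall x, x \in S ->
        exists s, [/\ oriented s, x \in s & fully_placed S lab f s \/ half_placed S lab
          f s]].

(** Kept apart from [partial] since it fails halfway through O3, when [b] has no placed neighbour
    except [d]. *)
Definition ends_inside S : Prop :=
  forall x t, x \in S -> oriented (x :: t) -> 1 < nb e S x.

Section AddPath.
Variables (S : {set V}) (n : nat) (adj : rel nat) (lab : nat -> status) (f : V -> nat).
Hypothesis part : partial S n adj lab f.
Variables (x y z : V) (l1 l2 : status).
Hypotheses (xS : x \in S) (yS : y \notin S) (zS : z \notin S) (nyz : y != z).
Hypotheses (exy : e x y) (eyz : e y z).
Let S' := z |: (y |: S).
Let f' v := if v == z then n.+1 else if v == y then n else f v.
Let adj' := add_edge (add_edge adj (f x) n) n n.+1.
Let lab' := upd (upd lab n l1) n.+1 l2.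

Lemma path_neq v : v \in S -> (v == y = false) * (v == z = false).
Proof. by move=> vS; split; [apply: contraNF yS|apply: contraNF zS] => /eqP <-. Qed.

Lemma path_f v : v \in S -> f' v = f v.
Proof. by move=> vS; rewrite /f' !path_neq. Qed.

Lemma path_lab v : v \in S -> lab' (f' v) = lab (f v).
Proof.
case: part => emb _ _ _ _ vS; have vn := embedded_lt emb vS.
by rewrite path_f // /lab' /upd !ltn_eqF // ltnW.
Qed.

Lemma path_lab_new : lab' (f' y) = l1 /\ lab' (f' z) = l2.
Proof.
by rewrite /f' /lab' /upd (negPf nyz) !eqxx [n == n.+1]ltn_eqF.
Qed.

Lemma path_mem v : (v \in S') = [|| v == z, v == y | v \in S].
Proof. by rewrite !inE. Qed.

Lemma path_connected : connected e S'.
Proof.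
case: part => _ cS _ _ _; have cS1 := connected_add treeV cS xS exy.
by apply: (connected_add treeV cS1 (x := y)); rewrite // !inE eqxx.
Qed.

Lemma path_embedded : embedded e S' n.+2 adj' f'.
Proof.
case: part => emb cS _ _ _; have cS1 := connected_add treeV cS xS exy.
have emb1 := embedded_add treeV emb cS xS yS exy.
have yS1 : y \in y |: S by rewrite !inE eqxx.
have zS1 : z \notin y |: S by rewrite !inE negb_or eq_sym nyz.
by have := embedded_add treeV emb1 cS1 yS1 zS1 eyz; rewrite eqxx.
Qed.

Lemma path_full s : fully_placed S lab f s -> fully_placed S' lab' f' s.
Proof.
move=> [sS ls]; split; first by move=> v /sS vS; rewrite path_mem vS !orbT.
rewrite (_ : map (lab' \o f') s = map (lab \o f) s) //.
by apply/eq_in_map => v /sS vS /=; rewrite path_lab.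
Qed.

Lemma path_half s : y \notin s -> z \notin s -> half_placed S lab f s -> half_placed S'
  lab' f' s.
Proof.
move=> ys zs [a [c [d [b [Es /andP[aS cS] /andP[dS bS] la lc]]]]].
exists a, c, d, b; rewrite !path_mem aS cS !orbT (negPf dS) (negPf bS) !orbF !path_lab //.
split=> //; move: ys zs; rewrite Es !inE !negb_or ![y == _]eq_sym ![z == _]eq_sym.
by case/and4P=> _ _ -> -> /and4P[_ _ -> ->].
Qed.

Lemma path_basic : l2 <> SA ->
  forall v, v \in S' -> lab' (f' v) = SA -> f' v < 4 -> deg e v = 2.
Proof.
have [_ _ n3 bas _] := part; have [ly lz] := path_lab_new.
move=> l2A v; rewrite path_mem => /or3P[/eqP->|/eqP->|vS].
- by rewrite lz => /l2A.
- by rewrite /f' (negPf nyz) eqxx; lia.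
- by rewrite path_lab // path_f //; apply: bas.
Qed.

(** The attachment vertex [x] may start with a single neighbour, as [b] does inside O3; the new
    vertex [y] is its second one. *)
Lemma path_ends : (forall v t, v \in S -> v != x -> oriented (v :: t) -> 1 < nb e S v) ->
  0 < nb e S x -> (forall t, ~ oriented (z :: t)) -> ends_inside S'.
Proof.
move=> ends nbx zend v t; have sub : S \subset S' by apply/subsetP => u uS;
  rewrite path_mem uS !orbT.
rewrite path_mem => /or3P[/eqP->|/eqP->|vS].
- by move/zend.
- move=> _; have nxz : x != z by apply: contraNneq zS => <-.
  by apply: (nb_gt1 (a := x) (b := z)); rewrite ?path_mem ?xS ?eqxx ?orbT // esym.
have [->|nvx] := eqVneq v x; last first.
  by move=> /(ends v t vS nvx) H; apply: leq_trans H (nb_mono _ _ sub).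
move=> _; rewrite /S' setUA setUC nbU; last first.
  rewrite disjoint_subset; apply/subsetP => w wS.
  by rewrite !inE !path_neq.
by rewrite -[2]addn1 leq_add //; apply: (nb_gt0 (w := y)); rewrite // !inE eqxx orbT.
Qed.

End AddPath.

Lemma oriented_disjoint s s' : oriented s -> oriented s' ->
  (exists2 v, v \in s & v \notin s') -> {in s, forall v, v \notin s'}.
Proof.
move=> os os' [v vs vs'] w ws; apply: contra vs' => ws'.
by rewrite -(oriented_mem uniqL os os' ws ws').
Qed.

Lemma grow_pair S n adj lab f x y c t : partial S n adj lab f ->
  x \in S -> e x y -> oriented [:: y, c & t] ->
  {in [:: y, c & t], forall v, v \notin S} ->
  partial (c |: (y |: S)) n.+2 (add_edge (add_edge adj (f x) n) n n.+1)
    (upd (upd lab n SA) n.+1 SC)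
    (fun v => if v == c then n.+1 else if v == y then n else f v).
Proof.
move=> part xS exy os off.
have yS : y \notin S by apply: off; rewrite inE eqxx.
have cS : c \notin S by apply: off; rewrite !inE eqxx orbT.
have Us := oriented_uniq uniqL os; have gs := oriented_good treeV goodL uniqL os.
have nyc : y != c by move: Us; rewrite /= inE negb_or => /andP[/andP[]].
have eyc : e y c by case: (t) gs => [|d [|b []]] // /andP[] // /andP[].
have [_ _ n3 _ core] := part; split.
- exact: (path_embedded part xS yS cS nyc exy eyc).
- exact: (path_connected part xS exy eyc).
- exact: leq_trans n3 (leq_trans (leqnSn _) (leqnSn _)).
- by apply: (path_basic part xS yS cS nyc exy eyc).
have [ly lc] := path_lab_new n lab f SA SC nyc.
have new v : v \in [:: y; c] -> exists s, [/\ oriented s, v \in s &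
    fully_placed (c |: (y |: S)) (upd (upd lab n SA) n.+1 SC)
      (fun v => if v == c then n.+1 else if v == y then n else f v) s \/
    half_placed (c |: (y |: S)) (upd (upd lab n SA) n.+1 SC)
      (fun v => if v == c then n.+1 else if v == y then n else f v) s].
  move=> vyc; exists [:: y, c & t]; split=> //.
    by move: vyc; rewrite !inE => /orP[] ->; rewrite ?orbT.
  case: t os off Us gs => [|d [|b []]] // os off Us gs.
    left; split; last by left; rewrite /= ly lc.
    by move=> w; rewrite !inE => /orP[] ->; rewrite ?orbT.
  right; exists y, c, d, b; split=> //; rewrite !path_mem ?eqxx ?orbT //.
  rewrite (negPf (off d _)) ?(negPf (off b _)) ?inE ?eqxx ?orbT // !orbF.
  move: Us; rewrite /= !inE !negb_or ![d == _]eq_sym ![b == _]eq_sym.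
  by case/and4P=> /and3P[_ -> ->] /andP[-> ->].
move=> v; rewrite path_mem => /or3P[vc|vy|vS].
- by apply: new; rewrite !inE vc orbT.
- by apply: new; rewrite !inE vy.
have [s [os' vs plc]] := core v vS; exists s; split=> //.
case: plc => [cs|hs]; first by left; exact: (path_full part _ _ yS cS cs).
right; have [a [c' [d [b [Es /andP[aS _] _ _ _]]]]] := hs.
have offs : {in [:: y, c & t], forall w, w \notin s}.
  apply: oriented_disjoint => //; exists y; rewrite ?mem_head //.
  apply/negP => ys; have := oriented_mem uniqL os' os ys (mem_head _ _) a.
  by rewrite Es mem_head => E; have := off a; rewrite -E aS => /(_ isT).
by apply: (path_half part _ _ yS cS) => //; apply: offs; rewrite !inE eqxx ?orbT.
Qed.

Lemma grow_quad S n adj lab f a c d b : partial S n adj lab f ->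
  oriented [:: a; c; d; b] -> a \in S -> c \in S -> d \notin S -> b \notin S ->
  lab (f a) = SA -> lab (f c) = SC ->
  partial (b |: (d |: S)) n.+2 (add_edge (add_edge adj (f c) n) n n.+1)
    (upd (upd lab n SD) n.+1 SB)
    (fun v => if v == b then n.+1 else if v == d then n else f v).
Proof.
move=> part os aS cS dS bS la lc.
have := oriented_uniq uniqL os; have := oriented_good treeV goodL uniqL os.
case/and5P=> /and3P[eac ecd edb] _ _ _ _; rewrite /= !inE !negb_or.
case/and4P=> _ _ ndb _.
have [_ _ n3 _ core] := part; split.
- exact: (path_embedded part cS dS bS ndb ecd edb).
- exact: (path_connected part cS ecd edb).
- exact: leq_trans n3 (leq_trans (leqnSn _) (leqnSn _)).
- by apply: (path_basic part cS dS bS ndb ecd edb).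
have [ld lb] := path_lab_new n lab f SD SB ndb.
have new v : v \in [:: a; c; d; b] -> exists s, [/\ oriented s, v \in s &
    fully_placed (b |: (d |: S)) (upd (upd lab n SD) n.+1 SB)
      (fun v => if v == b then n.+1 else if v == d then n else f v) s \/
    half_placed (b |: (d |: S)) (upd (upd lab n SD) n.+1 SB)
      (fun v => if v == b then n.+1 else if v == d then n else f v) s].
  move=> vs; exists [:: a; c; d; b]; split=> //; left; split.
    move=> w; rewrite path_mem !inE => /or4P[] /eqP ->; rewrite ?aS ?cS ?eqxx ?orbT //.
  right; rewrite /= ld lb -la -lc; congr [:: _; _; _; _].
    by rewrite (path_lab part).
  by rewrite (path_lab part).
move=> v; rewrite path_mem => /or3P[vb|vd|vS].
- by apply: new; rewrite !inE vb !orbT.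
- by apply: new; rewrite !inE vd !orbT.
have [vs|vs] := boolP (v \in [:: a; c; d; b]); first exact: new.
have [s [os' vs' plc]] := core v vS; exists s; split=> //.
case: plc => [cs|hs]; first by left; exact: (path_full part _ _ dS bS cs).
right; have offs : {in [:: a; c; d; b], forall w, w \notin s}.
  move=> w ws; apply: contra vs => ws'.
  by rewrite (oriented_mem uniqL os os' ws ws').
by apply: (path_half part _ _ dS bS) => //; apply: offs; rewrite !inE eqxx ?orbT.
Qed.

End Growth.

(** * Reaching the whole tree by the operations *)

Section Build.
Variables (V : finType) (e : rel V).
Hypothesis treeV : is_tree e.
Implicit Types (S : {set V}) (s t : seq V) (x y z a b c d : V).
Implicit Types (n : nat) (adj : rel nat) (lab : nat -> status) (f : V -> nat).
Let esym : symmetric e. Proof. by case: treeV => [[]]. Qed.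
Let eirr : irreflexive e. Proof. by case: treeV => [[]]. Qed.

Lemma nb_le_deg S v : nb e S v <= deg e v.
Proof. by rewrite deg_nb; apply: nb_mono; apply: subsetT. Qed.

Lemma nb_lt_deg S v w : w \notin S -> e v w -> nb e S v < deg e v.
Proof.
move=> wS evw; apply: proper_card; apply/properP; split.
  by apply/subsetP => u; rewrite !inE => /andP[].
by exists w; rewrite !inE ?(negPf wS).
Qed.

Variable L : seq (seq V).
Hypotheses (goodL : all (good_piece e) L) (uniqL : uniq (flatten L)).
Hypothesis fullL : flatten L =i [set: V].
Local Notation oriented := (oriented L).

Definition built S : Prop := exists n adj lab f,
  [/\ inT2 n adj lab, partial e L S n adj lab f & ends_inside e L S].

Lemma built_start : 1 < #|V| -> exists S, built S.
Proof.
move=> /(exists_basic_edge treeV goodL uniqL fullL) [x [c [t [y [c' [t' [os os' exy dx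
  dy]]]]]]].
have eyx : e y x by rewrite esym.
have good2 u cu tu : oriented [:: u, cu & tu] -> e u cu /\ u != cu.
  move=> ou; have := oriented_good treeV goodL uniqL ou; have := oriented_uniq uniqL ou.
  rewrite cons_uniq inE negb_or => /andP[/andP[nu _] _] gu; split=> //.
  by case: tu ou gu => [|d [|b []]] // _ /andP[] // /andP[].
have [exc nxc] := good2 _ _ _ os; have [eyc' nyc'] := good2 _ _ _ os'.
have ecx : e c x by rewrite esym.
have ys : y \notin [:: x, c & t] := end_edge_off treeV goodL uniqL os os' exy.
have off v : v \in [:: y, c' & t'] -> v \notin [:: x, c & t].
  apply: (oriented_disjoint uniqL os' os); exists y => //; exact: mem_head.
have off' v : v \in [:: x, c & t] -> v \notin [:: y, c' & t'].
  by move=> vs; apply/negP => /off; rewrite vs.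
have c's : c' \notin [:: x, c & t] by apply: off; rewrite !inE eqxx orbT.
have [nyx nycc] : y != x /\ y != c by move: ys; rewrite !inE !negb_or => /and3P[].
have [nc'x nc'c] : c' != x /\ c' != c by move: c's; rewrite !inE !negb_or => /and3P[].
(* The basic path [c x y c'] is placed one vertex at a time, so that the numbers are 0, 1, 2, 3 as
   in [p4_adj]. *)
have E0 : embedded e [set c] 1 (fun _ _ => false) (fun _ => 0).
  split=> //; first by rewrite enum_set1.
  by move=> u v; rewrite !inE => /eqP-> /eqP->; rewrite eirr.
have C0 := @connected1 V e c.
have xS0 : x \notin [set c] by rewrite inE.
have E1 := embedded_add treeV E0 C0 (set11 c) xS0 ecx.
have C1 := connected_add treeV C0 (set11 c) ecx.
have xS1 : x \in x |: [set c] by rewrite !inE eqxx.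
have yS1 : y \notin x |: [set c] by rewrite !inE negb_or nyx.
have E2 := embedded_add treeV E1 C1 xS1 yS1 exy.
have C2 := connected_add treeV C1 xS1 exy.
have yS2 : y \in y |: (x |: [set c]) by rewrite !inE eqxx.
have c'S2 : c' \notin y |: (x |: [set c]).
  by rewrite !inE !negb_or eq_sym nyc' nc'x.
have E3 := embedded_add treeV E2 C2 yS2 c'S2 eyc'.
have C3 := connected_add treeV C2 yS2 eyc'.
rewrite !eqxx in E3; set f := (f in embedded _ _ _ _ f) in E3.
set S := c' |: _ in E3 C3.
have inS v : (v \in S) = [|| v == c', v == y, v == x | v == c] by rewrite !inE.
have [fc' fy fx fc] : [/\ f c' = 3, f y = 2, f x = 1 & f c = 0].
  by rewrite /f !eqxx (negPf nyc') ![_ == c']eq_sym ![_ == y]eq_sym (negPf nc'x) (negPf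
    nc'c)
    (negPf nyx) (negPf nycc) eq_sym (negPf nxc).
clearbody f S; exists S, 4, p4_adj, p4_lab, f; split; first exact: T2_base.
- split=> //.
  + by move=> v; rewrite inS => /or4P[] /eqP->; rewrite ?fc' ?fc ?fx ?fy.
  have place u cu tu : oriented [:: u, cu & tu] -> u \in S -> cu \in S ->
      p4_lab (f u) = SA -> p4_lab (f cu) = SC -> {in tu, forall v, v \notin S} ->
      forall v, v \in [:: u; cu] -> exists s,
      [/\ oriented s, v \in s & fully_placed S p4_lab f s \/ half_placed S p4_lab f s].
    move=> ou uS cuS lu lcu tuS v vu; exists [:: u, cu & tu]; split=> //.
      by move: vu; rewrite !inE => /orP[] ->; rewrite ?orbT.
    have := oriented_good treeV goodL uniqL ou.
    case: tu tuS {ou} => [|d [|b []]] // tuS _.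
      left; split; last by left; rewrite /= lu lcu.
      by move=> w; rewrite !inE => /orP[] /eqP->.
    right; exists u, cu, d, b; split; rewrite ?uS //.
    by rewrite !tuS // !inE eqxx ?orbT.
  move=> v; rewrite inS orbA orbC => /orP[] vs.
    apply: (place x c t) => //; rewrite ?inS ?eqxx ?orbT ?fx ?fc ?inE //.
    move=> w wt; have := off' w; have := oriented_uniq uniqL os.
    rewrite /= !in_cons !negb_or inS wt !orbT => /andP[/andP[_ xt] /andP[ct _]] /(_ isT).
    case/and3P=> /negPf-> /negPf-> _ /=.
    by rewrite negb_or; apply/andP; split; apply: contraTneq wt => ->.
  apply: (place y c' t') => //; rewrite ?inS ?eqxx ?orbT ?fy ?fc' //; last first.
    by rewrite !inE orbC.
  move=> w wt; have := off w; have := oriented_uniq uniqL os'.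
  rewrite /= !in_cons !negb_or inS wt !orbT => /andP[/andP[_ yt] /andP[ct _]] /(_ isT).
  case/and3P=> /negPf-> /negPf-> _; rewrite !orbF.
  by rewrite negb_or; apply/andP; split; apply: contraTneq wt => ->.
move=> v tv; rewrite inS => /or4P[] /eqP-> ov.
- by case: (oriented_end_inner treeV goodL uniqL ov os').
- by apply: (nb_gt1 (a := x) (b := c')); rewrite ?inS ?eqxx ?orbT // eq_sym.
- by apply: (nb_gt1 (a := y) (b := c)); rewrite ?inS ?eqxx ?orbT.
- by case: (oriented_end_inner treeV goodL uniqL ov os).
Qed.

Lemma placed_ind_path S n adj f a c d b : embedded e S n adj f ->
  oriented [:: a; c; d; b] -> {subset [:: a; c; d; b] <= S} ->
  ind_path4 n adj (f a) (f c) (f d) (f b).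
Proof.
move=> emb os sub.
have [aS cS dS bS] : [/\ a \in S, c \in S, d \in S & b \in S].
  by split; apply: sub; rewrite !inE eqxx ?orbT.
have [wf _ fE] := emb; have lt := embedded_lt emb.
have := oriented_uniq uniqL os; have := oriented_good treeV goodL uniqL os.
case/and5P=> /and3P[eac ecd edb] _ _ _ _; rewrite /= !inE !negb_or.
case/and4P=> /and3P[nac nad nab] /andP[ncd ncb] ndb _.
have ne u v : u \in S -> v \in S -> u != v -> f u != f v.
  by move=> uS vS; apply: contraNneq => /(embedded_inj emb)->.
split; first by split; rewrite ?lt //= !inE !negb_or !ne.
split; first by rewrite !fE.
by rewrite !fE // (triangle_free treeV eac ecd) (triangle_free treeV ecd edb)
  (square_free treeV eac ecd edb).
Qed.

(** O3 adds four vertices, so completing the path requires the next pair at once. It starts at a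
    second neighbour [y] of [b], which exists because ends have degree at least 2. The vertex [c] is
    a leaf of the built part because [d] is missing. *)
Lemma built_half S a c d b : built S -> oriented [:: a; c; d; b] ->
  a \in S -> c \in S -> d \notin S -> exists S', S \proper S' /\ built S'.
Proof.
move=> [n [adj [lab [f [T part ends]]]]] os aS cS dS.
have [emb conn n3 bas core] := part; have lt := embedded_lt emb.
have [bS la lc] : [/\ b \notin S, lab (f a) = SA & lab (f c) = SC].
  have [s [os' as' [[sub _]|hs]]] := core a aS.
    have := sub d; rewrite -(oriented_mem uniqL os os' (mem_head _ _) as') !inE eqxx
      !orbT.
    by move=> /(_ isT); rewrite (negPf dS).
  have [a' [c' [d' [b' [Es /andP[a'S c'S] /andP[d'S b'S] la lc]]]]] := hs.
  case: (oriented_same uniqL os os' (mem_head _ _) as') => [E|[_ E]]; rewrite Es in E.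
    by case: E => *; subst.
  by move: E d'S; rewrite /rev /= => -[_ _ -> _]; rewrite cS.
have := oriented_uniq uniqL os; have := oriented_good treeV goodL uniqL os.
case/and5P=> /and3P[eac ecd edb] /eqP dc _ /andP[_ db1] _; rewrite /= !inE !negb_or.
case/and4P=> /and3P[nac nad nab] /andP[ncd ncb] ndb _.
have os' : oriented [:: b; d; c; a] by rewrite -oriented_rev.
have ebd : e b d by rewrite esym.
have edc : e d c by rewrite esym.
have cS1 := connected_add treeV conn cS ecd.
have dS1 : d \in d |: S by rewrite !inE eqxx.
have bS1 : b \notin d |: S by rewrite !inE negb_or eq_sym ndb.
have part2 := grow_quad treeV goodL uniqL part os aS cS dS bS la lc.
set S2 := b |: (d |: S) in part2.
have inS2 v : (v \in S2) = [|| v == b, v == d | v \in S] by rewrite !inE.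
clearbody S2.
have [y] : exists y, y \in [set y | e b y] :\ d.
  apply/set0Pn; rewrite -card_gt0.
  by move: db1; rewrite /deg (cardsD1 d) inE ebd.
rewrite !inE => /andP[nyd eby].
have nyb : y != b by rewrite eq_sym (edge_neq treeV eby).
have yS : y \notin S.
  apply: contra nyd => yS; apply/eqP.
  by apply: (connected_unique treeV cS1 bS1) => //; rewrite !inE yS orbT.
have yS2 : y \notin S2 by rewrite inS2 !negb_or nyb nyd.
have nys : y \notin [:: b; d; c; a].
  rewrite !inE !negb_or nyb nyd /=.
  by apply/andP; split; apply: contraNneq yS => ->.
have [c4 [t4 oq]] := end_neighbor treeV goodL uniqL fullL os' eby nys.
have offs : {in [:: y, c4 & t4], forall v, v \notin [:: b; d; c; a]}.
  by apply: (oriented_disjoint uniqL oq os'); exists y; rewrite ?mem_head.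
have offS2 : {in [:: y, c4 & t4], forall v, v \notin S2}.
  move=> v vq; rewrite inS2 !negb_or; have := offs v vq.
  rewrite !inE !negb_or => /and4P[-> -> _ _] /=; apply/negP => vS.
  have [s [os3 vs [[sub _]|hs]]] := core v vS.
    have := sub y; rewrite -(oriented_mem uniqL oq os3 vq vs) mem_head => /(_ isT).
    by rewrite (negPf yS).
  (* Otherwise the piece of [y] is half placed with [y] as its far end [b']; then [d'] has two
     neighbours [c'] and [y] in the connected set [y |: S2], which is impossible. *)
  have [a' [c' [d' [b' [Es /andP[a'S c'S] /andP[d'S b'S] _ _]]]]] := hs.
  have ndb' := oriented_uniq uniqL os3.
  subst s; have := oriented_good treeV goodL uniqL os3.
  case/and5P=> /and3P[_ ecd' edb'] _ _ _ _.
  case: (oriented_same uniqL os3 oq vs vq) => [[ya _]|[_]].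
    by move: yS; rewrite ya a'S.
  rewrite /rev /= => -[yb c4d _].
  have [_ conn2 _ _ _] := part2.
  have bS2 : b \in S2 by rewrite inS2 eqxx.
  have conn3 := connected_add treeV conn2 bS2 eby.
  have ndy : d' != y by have := oriented_uniq uniqL oq;
    rewrite /= inE negb_or eq_sym c4d => /andP[/andP[]].
  have d'S3 : d' \notin y |: S2.
    have := offs c4; rewrite !inE eqxx orbT c4d inS2 !negb_or ndy d'S => /(_ isT).
    by case/and4P=> -> ->.
  have cb : c' = b'.
    apply: (connected_unique treeV conn3 d'S3) => //; rewrite ?inE ?inS2 ?c'S ?orbT //.
      by rewrite yb eqxx.
    by rewrite esym.
  by move: ndb'; rewrite cb /= !inE eqxx !orbT /= andbF.
have bS2 : b \in S2 by rewrite inS2 eqxx.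
have part4 := grow_pair treeV goodL uniqL part2 bS2 eby oq offS2.
rewrite eqxx in part4.
have c4S2 : c4 \notin S2 by apply: offS2; rewrite !inE eqxx orbT.
have nyc4 : y != c4 by have := oriented_uniq uniqL oq;
  rewrite /= inE negb_or => /andP[/andP[]].
have eyc4 : e y c4.
  have := oriented_good treeV goodL uniqL oq.
  by case: (t4) => [|d4 [|b4 []]] // /andP[] // /andP[].
have sub2 : S \subset S2 by apply/subsetP => v vS; rewrite inS2 vS !orbT.
exists (c4 |: (y |: S2)); split.
  apply/properP; split; first by rewrite setUA (subset_trans sub2) ?subsetUr.
  by exists y; rewrite // !inE eqxx orbT.
do 4 eexists; split; [|exact: part4|].
- apply: T2_O3 => //; first exact: lt.
  rewrite (embedded_deg emb cS); apply/eqP; rewrite eqn_leq; apply/andP; split.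
    by rewrite -ltnS -dc; apply: nb_lt_deg ecd.
  by apply: (nb_gt0 (w := a)); rewrite // esym.
apply: (path_ends treeV bS2 yS2 c4S2 eby eyc4).
- move=> v t; rewrite inS2 => /or3P[/eqP->|/eqP->|vS] nvb ov.
  + by rewrite eqxx in nvb.
  + by case: (oriented_end_inner treeV goodL uniqL ov os').
  + by apply: leq_trans (ends v t vS ov) (nb_mono _ _ sub2).
- by apply: (nb_gt0 (w := d)); rewrite // inS2 eqxx orbT.
- by move=> t ov; case: (oriented_end_inner treeV goodL uniqL ov oq).
Qed.

(** Since every piece meeting [S] is fully placed, an edge leaving [S] starts at an end, whose
    degree exceeds 2 by [ends_inside]. This rules out a pair, and in a path it makes the other end
    the corresponding vertex of degree 2. *)
Lemma built_pair S x y : built S ->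
  (forall a c d b, oriented [:: a; c; d; b] -> a \in S -> c \in S -> d \in S) ->
  x \in S -> y \notin S -> e x y -> exists S', S \proper S' /\ built S'.
Proof.
move=> [n [adj [lab [f [T part ends]]]]] nohalf xS yS exy.
have [emb conn n3 bas core] := part; have lt := embedded_lt emb.
have full v : v \in S -> exists s, [/\ oriented s, v \in s & fully_placed S lab f s].
  move=> /core[s [os vs [?|[a [c [d [b [Es /andP[aS cS] /andP[dS bS] _ _]]]]]]]];
    first by exists s.
  by rewrite Es in os; move: dS; rewrite (nohalf _ _ _ _ os).
have [s [os xs [sS ls]]] := full x xS.
have ys : y \notin s by apply: contra yS => /sS.
have endx t : oriented (x :: t) -> 2 < deg e x.
  by move=> ox; apply: leq_ltn_trans (ends x t xS ox) (nb_lt_deg yS exy).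
have grow t : oriented (x :: t) -> s =i x :: t ->
    inT2 n.+2 (add_edge (add_edge adj (f x) n) n n.+1) (upd (upd lab n SA) n.+1 SC) ->
    exists S', S \proper S' /\ built S'.
  move=> ox sx T'; rewrite sx in ys.
  have [cy [ty oy]] := end_neighbor treeV goodL uniqL fullL ox exy ys.
  have off : {in [:: y, cy & ty], forall v, v \notin S}.
    move=> v vq; apply/negP => /full[s' [os' vs' [sS' _]]].
    have := sS' y; rewrite -(oriented_mem uniqL oy os' vq vs') mem_head => /(_ isT).
    by rewrite (negPf yS).
  have part' := grow_pair treeV goodL uniqL part xS exy oy off.
  have cyS : cy \notin S by apply: off; rewrite !inE eqxx orbT.
  have eycy : e y cy.
    have := oriented_good treeV goodL uniqL oy.
    by case: (ty) => [|d4 [|b4 []]] // /andP[] // /andP[].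
  exists (cy |: (y |: S)); split.
    apply/properP; split; first by rewrite setUA subsetUr.
    by exists y; rewrite // !inE eqxx orbT.
  do 4 eexists; split; [exact: T'|exact: part'|].
  apply: (path_ends treeV xS yS cyS exy eycy).
  - by move=> v t' vS _ ov; apply: ends ov.
  - by apply: leq_trans (ends x t xS ox).
  - by move=> t' ov; case: (oriented_end_inner treeV goodL uniqL ov oy).
have noinner a t : oriented [:: a, x & t] -> s =i [:: a, x & t] -> False.
  by move=> oa sa; move: ys; rewrite sa (inner_neighbor treeV goodL uniqL oa).
have := oriented_good treeV goodL uniqL os.
case: s os xs sS ls ys grow noinner => [|a [|c [|d [|b []]]]] // os xs sS ls ys grow
  noinner gs.
  move: xs gs; rewrite !inE => /orP[] /eqP E; subst.
    by case/and3P=> _ /eqP da _; have := endx _ os; rewrite da.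
  by case: (noinner _ _ os).
have [aS cS dS bS] : [/\ a \in S, c \in S, d \in S & b \in S].
  by split; apply: sS; rewrite !inE eqxx ?orbT.
have os' : oriented [:: b; d; c; a] by rewrite -oriented_rev.
have Erev : [:: a; c; d; b] =i [:: b; d; c; a].
  by move=> v; rewrite -mem_rev.
have P := placed_ind_path emb os sS.
case: ls => [//|[la lc ld lb]].
have deg2 v t : v \in S -> oriented (v :: t) -> deg e v = 2 -> ndeg n adj (f v) = 2.
  move=> vS ov dv; rewrite (embedded_deg emb vS); apply/eqP.
  by rewrite eqn_leq (ends v t vS ov) -{1}dv nb_le_deg.
case/and5P: gs => /and3P[eac ecd edb] dc dd _ dab.
move: xs; rewrite !inE => /or4P[] /eqP E; subst.
- have dx := endx _ os; rewrite (gtn_eqF dx) /= in dab.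
  (* [a] is off the basic path because its degree exceeds 2. *)
  apply: (grow _ os) => //; apply: T2_O4 => //; first exact: lt.
    rewrite /on_basic -leqNgt leqNgt; apply/negP => /(bas a aS la) E.
    by rewrite E in dx.
  exists (f b); split; first exact: lt.
  split; last by apply: deg2 os' (eqP dab).
  have lt4 : ~~ on_basic (f a).
    by rewrite /on_basic; apply/negP => /(bas a aS la) E; rewrite E in dx.
  split=> //; split; last by split=> //; exists (f c), (f d).
  (* A leaf [v] of the built part adjacent to [a] is no end, since ends have two placed neighbours.
     So it is inner and belongs to the piece of [a]; but [c] has the placed neighbours [a] and [d],
     and [d] is not adjacent to [a]. *)
  case=> w [wn [aw w1]]; have [v vS Ev] := embedded_onto emb wn; subst w.
  have [_ _ fE] := emb; rewrite fE // in aw; rewrite (embedded_deg emb vS) in w1.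
  have [[c' [t' ov]]|[a' [t' ov]]] := oriented_cases treeV goodL uniqL fullL v.
    by have := ends v _ vS ov; rewrite w1.
  have av : a \in [:: a', v & t'].
    by apply: (inner_neighbor treeV goodL uniqL ov); rewrite esym.
  case: (oriented_same uniqL os ov (mem_head _ _) av) => [[_ vc _]|[_]].
    have eca : e c a by rewrite esym.
    have nad : a != d by have := oriented_uniq uniqL os;
      rewrite /= !inE !negb_or => /andP[/and3P[]].
    by have := nb_gt1 aS dS nad eca ecd; rewrite -vc w1.
  rewrite /rev /= => -[_ vd _]; move: aw; rewrite vd.
  by rewrite (triangle_free treeV eac ecd).
- by case: (noinner _ _ os).
- by case: (noinner _ _ os').
have db := endx _ os'; rewrite (gtn_eqF db) orbF in dab.
apply: (grow _ os') => //; apply: T2_O2 => //; first exact: lt.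
exists (f a); split; first exact: lt.
split; last by apply: deg2 os (eqP dab).
by split=> //; exists (f c), (f d).
Qed.

(** Half placed pieces are completed first; when none is left, any edge leaving [S] allows O2 or
    O4. *)
Lemma built_all : 1 < #|V| -> built setT.
Proof.
move=> V1; have [S0 B0] := built_start V1.
have [m le_m] := ubnP (#|V| - #|S0|); elim: m S0 le_m B0 => // m IHm S le_m B.
have [<- //|nST] := eqVneq S setT.
suff [S' [SS' B']] : exists S', S \proper S' /\ built S'.
  apply: (IHm S') B'; have := proper_card SS'; have := max_card (mem S').
  by move: le_m; rewrite -cardsE; move: #|S| #|S'| #|V|; lia.
have [n [adj [lab [f [T part ends]]]]] := B.
have [emb _ n3 _ _] := part; have [v0 v0S _] := embedded_onto emb (ltn_trans (isT : 0 <
  3) n3).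
have [w wS] : exists w, w \notin S.
  by apply/existsP; rewrite -negb_forall; apply: contraNN nST => /forallP H;
    apply/eqP/setP => v; rewrite inE H.
have [x [y [xS yS exy]]] : exists x y, [/\ x \in S, y \notin S & e x y].
  have [/existsP[x /existsP[y /and3P[]]]|/existsPn H] :=
      boolP [exists x, [exists y, [&& x \in S, y \notin S & e x y]]];
        first by exists x, y.
  have [_ [conn _]] := treeV; case/negP: wS.
  apply: (connect_inv (Q := fun v => v \in S) _ (conn v0 w) v0S) => u v euv uS.
  by have /existsPn/(_ v) := H u; rewrite uS euv andbT negbK.
have [/existsP[a /existsP[c /existsP[d /existsP[b /and4P[os aS cS dS]]]]]|H] :=
    boolP [exists a, [exists c, [exists d, [exists b,
      [&& oriented [:: a; c; d; b], a \in S, c \in S & d \notin S]]]]].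
  exact: built_half B os aS cS dS.
apply: (built_pair B) xS yS exy => a c d b os aS cS; apply: contraNT H => dS.
by apply/existsP; exists a; apply/existsP; exists c; apply/existsP; exists d;
  apply/existsP; exists b; rewrite os aS cS.
Qed.

Lemma built_labeling : 1 < #|V| -> has_T2_labeling e.
Proof.
move=> /built_all [n [adj [lab [f [T [emb _ _ _ _] _]]]]]; exists n, adj, lab; split=> //.
exists f; split.
- by move=> x; apply: (embedded_lt emb).
- by move=> x y; apply: (embedded_inj emb).
- by move=> k /(embedded_onto emb)[x _ <-]; exists x.
- by move=> x y; case: emb => _ _ ->.
Qed.

End Build.

Lemma tiled_has_T2_labeling (V : finType) (e : rel V) :
  is_tree e -> 1 < #|V| -> tiled e setT -> has_T2_labeling e.
Proof. by move=> te V1 [L [gL UL LT]]; apply: (built_labeling te gL UL LT). Qed.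

Theorem theorem2p4 (V : finType) (e : rel V) :
  is_tree e -> 2 <= #|V| ->
  4 * gamma2d e <= #|V| + nleaves e + nsupports e /\
  (4 * gamma2d e = #|V| + nleaves e + nsupports e <-> has_T2_labeling e).
Proof.
move=> te V1; have [bound eq_tiled] := gamma2d_bound te V1; split=> //; split.
  by move=> E; apply: tiled_has_T2_labeling => //; apply: eq_tiled.
move=> /has_T2_labeling_tiled/tiled_gamma2d lower; apply/eqP.
by rewrite eqn_leq bound lower //; case: te.
Qed.
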